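(* Let $\Pi=(\pi_n)_{n\in\mathbb{N}}$ be a sequence of partitions of $\mathbb{R}_{\ge 0}$ with $|\pi_n|\to 0$. Let $X\in QV(\Pi;\mathbb{R}^d)$, let $\xi^{(1)},\dots,\xi^{(\nu)}$ be admissible integrands of $X$, and set $Y^k_t=\int_0^t\langle\xi^{(k)}_{s-},dX_s\rangle$ for $k=1,\dots,\nu$ and $Y=(Y^1,\dots,Y^\nu)$. Let $\eta=(\eta^1,\dots,\eta^\nu)$ be a $\nu$-dimensional càdlàg path. Then, for $t\in\mathbb{R}_{\ge0}$, the Itô–Föllmer integral $\int_0^t\langle\eta_{s-},dY_s\rangle$ exists if and only if the Itô–Föllmer integral $\int_0^t\big\langle\sum_{k=1}^\nu\eta^k_{s-}\xi^{(k)}_{s-},dX_s\big\rangle$ exists. If one of them exists, then $$\int_0^t\langle\eta_{s-},dY_s\rangle=\int_0^t\Big\langle\sum_{k=1}^\nu\eta^k_{s-}\xi^{(k)}_{s-},dX_s\Big\rangle .$$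
   Context: Conventions. A càdlàg path is a function on $\mathbb{R}_{\ge 0}$ that is right continuous with finite left limits; $X_{0-}=X_0$, $\Delta X_t=X_t-X_{t-}$. A partition is $\pi=(t_i)_{i\in\mathbb{N}}$ with $0=t_0<t_1<\cdots\to\infty$, and $|\pi|=\sup_i|t_{i+1}-t_i|$. Quadratic variation. A real càdlàg path $X$ has quadratic variation along $\Pi=(\pi_n)$ if $t\mapsto\sum_{t_i\in\pi_n}(X_{t_{i+1}\wedge t}-X_{t_i\wedge t})^2$ converges pointwise to a càdlàg increasing function $[X,X]$ with $\Delta[X,X]_t=(\Delta X_t)^2$ for all $t\ge0$. An $\mathbb{R}^d$-valued càdlàg path $X$ has quadratic variation along $\Pi$ if $X^i+X^j$ does for all $i,j$. $QV(\Pi;\mathbb{R}^d)$ is the set of such paths. $FV_{\mathrm{loc}}$ is the set of real càdlàg paths of locally finite variation. Itô–Föllmer integral. For càdlàg $\xi$ and $X$ in $\mathbb{R}^d$, $\int_0^t\langle\xi_{s-},dX_s\rangle:=\lim_{n\to\infty}\sum_{t_i\in\pi_n}\langle\xi_{t_i},X_{t_{i+1}\wedge t}-X_{t_i\wedge t}\rangle$; it is said to exist if this limit exists and is finite. Admissible integrands. A function $f(a,x)$ on an open $U\subset\mathbb{R}^m\times\mathbb{R}^d$ is of class $C^{1,2}$ if it is once continuously differentiable in $a$ and twice in $x$, with all these derivatives continuous in $(a,x)$ jointly. A $d$-dimensional càdlàg path $\xi$ is an admissible integrand of $X\in QV(\Pi;\mathbb{R}^d)$ if for any $T>0$ there exist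 $m\in\mathbb{N}$, an open $U\subset\mathbb{R}^m\times\mathbb{R}^d$, a real function $f$ of class $C^{1,2}$ on $U$, and $A\in FV_{\mathrm{loc}}^m$ such that $\xi_t=\nabla_xf(A_t,X_t)$ for all $t\in[0,T]$ and the image of $[0,T]\ni t\mapsto(A_t,X_t)\in U$ is relatively compact in $U$. For an admissible integrand $\xi$ of $X$ the integral $\int_0^t\langle\xi_{s-},dX_s\rangle$ exists for all $t\ge0$. *)

(* Defs.v *)
From HB Require Import structures.
From mathcomp Require Import all_boot all_order all_algebra.
From mathcomp Require Import all_classical all_reals all_analysis.

Set Implicit Arguments.
Unset Strict Implicit.
Unset Printing Implicit Defensive.

Import Order.TTheory GRing.Theory Num.Theory.
Import numFieldNormedType.Exports.

Local Open Scope classical_set_scope.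
Local Open Scope ring_scope.

(* A path indexed by the nonnegative half-line is a total function on R; its
   values at negative times are never used. *)

Definition cadlag (R : realType) (E : topologicalType) (x : R -> E) : Prop :=
  (forall t : R, 0 <= t -> x s @[s --> t^'+] --> x t) /\
  (forall t : R, 0 < t -> exists l : E, x s @[s --> t^'-] --> l).

(* The convention x_{0-} = x_0 is built in. *)
Definition left_lim (R : realType) (x : R -> R) (t : R) : R :=
  if t <= 0 then x t else lim (x s @[s --> t^'-]).

Definition jump (R : realType) (x : R -> R) (t : R) : R := x t - left_lim x t.

Definition is_partition (R : realType) (p : nat -> R) : Prop :=
  [/\ p 0%N = 0, (forall i, p i < p i.+1) & p i @[i --> \oo] --> +oo].

Definition mesh (R : realType) (p : nat -> R) : \bar R :=
  ereal_sup (range (fun i => `|p i.+1 - p i|%:E)).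

(* The partial sums of the series in [qv_sum] and [riemann_sum] are eventually
   constant, since the terms with t <= p i vanish. *)
Definition qv_sum (R : realType) (p : nat -> R) (x : R -> R) (t : R) : R :=
  limn (series (fun i => (x (Num.min (p i.+1) t) - x (Num.min (p i) t)) ^+ 2)).

Definition has_quadratic_variation (R : realType) (Pi : nat -> nat -> R)
    (x : R -> R) : Prop :=
  cadlag x /\
  exists Q : R -> R,
    [/\ (forall t : R, 0 <= t -> qv_sum (Pi n) x t @[n --> \oo] --> Q t),
        cadlag Q,
        {in `[0, +oo[ &, {homo Q : s t / s <= t}} &
        (forall t : R, 0 <= t -> jump Q t = jump x t ^+ 2)].

Definition QV (R : realType) (Pi : nat -> nat -> R) (d : nat) :
    set (R -> 'rV[R]_d) :=
  [set X : R -> 'rV[R]_d | cadlag X /\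
    forall i j : 'I_d,
      has_quadratic_variation Pi (fun t => X t ord0 i + X t ord0 j)].

Definition FV_loc (R : realType) : set (R -> R) :=
  [set a : R -> R | cadlag a /\ forall T, 0 <= T -> bounded_variation 0 T a].

Definition dot (R : realType) (d : nat) (u v : 'rV[R]_d) : R :=
  \sum_(j < d) u ord0 j * v ord0 j.

Definition riemann_sum (R : realType) (p : nat -> R) (d : nat)
    (xi X : R -> 'rV[R]_d) (t : R) : R :=
  limn (series (fun i =>
    dot (xi (p i)) (X (Num.min (p i.+1) t) - X (Num.min (p i) t)))).

Definition ito_follmer_integrable (R : realType) (Pi : nat -> nat -> R) (d : nat)
    (xi X : R -> 'rV[R]_d) (t : R) : Prop :=
  cvgn (fun n => riemann_sum (Pi n) xi X t).

(* Meaningful only under [ito_follmer_integrable Pi xi X t]. *)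
Definition ito_follmer_integral (R : realType) (Pi : nat -> nat -> R) (d : nat)
    (xi X : R -> 'rV[R]_d) (t : R) : R :=
  limn (fun n => riemann_sum (Pi n) xi X t).

Section C12.
Variables (R : realType) (m d : nat).
Implicit Types (f : 'rV[R]_m -> 'rV[R]_d -> R) (a : 'rV[R]_m) (x : 'rV[R]_d).

Definition unit_row (n : nat) (i : 'I_n) : 'rV[R]_n := delta_mx ord0 i.

Definition partial_a f (i : 'I_m) a x : R := 'D_(unit_row i) (fun b => f b x) a.

Definition partial_x f (j : 'I_d) a x : R := 'D_(unit_row j) (f a) x.

Definition partial_xx f (j k : 'I_d) a x : R :=
  'D_(unit_row k) (partial_x f j a) x.

Definition grad_x f a x : 'rV[R]_d := \row_j partial_x f j a x.

(* f is a total function, but since U is open all the conditions depend only on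
   its values in U. *)
Definition C12 (U : set ('rV[R]_m * 'rV[R]_d)) f : Prop :=
  [/\ (forall i p, U p ->
         derivable (fun b => f b p.2) p.1 (unit_row i) /\
         continuous_at p (fun q => partial_a f i q.1 q.2)),
      (forall j p, U p ->
         derivable (f p.1) p.2 (unit_row j) /\
         continuous_at p (fun q => partial_x f j q.1 q.2)) &
      (forall j k p, U p ->
         derivable (partial_x f j p.1) p.2 (unit_row k) /\
         continuous_at p (fun q => partial_xx f j k q.1 q.2))].

End C12.

(* closure S `&` U is the closure of S relative to U. *)
Definition relatively_compact_in (E : topologicalType) (U S : set E) : Prop :=
  S `<=` U /\ compact (closure S `&` U).

Definition admissible (R : realType) (d : nat) (X xi : R -> 'rV[R]_d) : Prop :=
  cadlag xi /\
  forall T : R, 0 < T ->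
    exists (m : nat) (U : set ('rV[R]_m * 'rV[R]_d))
           (f : 'rV[R]_m -> 'rV[R]_d -> R) (A : R -> 'rV[R]_m),
      [/\ open U,
          C12 U f,
          (forall i, FV_loc (fun t => A t ord0 i)),
          {in `[0, T], forall t, xi t = grad_x f (A t) (X t)} &
          relatively_compact_in U [set (A t, X t) | t in `[0, T]]].

(* Main.v *)
Require Import Defs.
From HB Require Import structures.
From mathcomp Require Import all_boot all_order all_algebra.
From mathcomp Require Import all_classical all_reals all_analysis.
From mathcomp Require Import ring lra.
Import Order.TTheory GRing.Theory Num.Theory.
Import numFieldNormedType.Exports.
Local Open Scope classical_set_scope.
Local Open Scope ring_scope.

Set Implicit Arguments.
Unset Strict Implicit.
Unset Printing Implicit Defensive.

(** The theorem is an associativity rule for left-point Riemann sums. Write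
    Y^k for the integral of xi^k against X, inc^k(v, w) for the scalar product
    of xi^k(v) with X(w) - X(v), and
      r^k(v, w) = Y^k(w) - Y^k(v) - inc^k(v, w)
    for the error of the one-step approximation of Y^k. The Riemann sum of eta
    against Y minus the Riemann sum of zeta against X is exactly the sum over k
    of the partition sums of eta^k(v) r^k(v, w). It suffices that each of them
    tends to 0 along the partitions ([weighted_residual_cvg0]); the two limits
    then exist together and coincide.

    Why the weighted residuals vanish. Without the weight the partition sums of
    r^k over any interval tend to 0, because Y^k is the limit of the sums of
    inc^k. On a short interval to the right of a time tau the weight is close
    to eta^k(tau), and on one to its left it is close to the left limit, so the
    weight may be frozen at the price of a small multiple of the partition sum
    of |r^k|. These absolute sums do not tend to 0, but they stay bounded:
    locally |r^k| is dominated by a constant times an interval function whose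
    partition sums converge to the increments of a function beta, made of the
    variations of A and the quadratic variations of X ([residual_bound]).

    That domination is where admissibility enters. A Taylor expansion of
    F = f(A, X) gives
      F(w) - F(v) = inc(v, w) + c . dA + sum_jk Q_jk dX^j dX^k + small error,
    with the first-order coefficients in A and the second-order coefficients in
    X frozen at (A, X)(tau), or at its left limit ([C12_expansion],
    [admissible_ito_expansion]). Hence |dF - inc| is locally at most a multiple
    of the control, and passing to the limit in the partition sums,
    so is |dY - dF|.

    The same expansion shows that the integral Y exists
    ([ito_follmer_exists]): locally the sums of inc differ from sums that
    converge for elementary reasons (a telescoping sum, and covariations) by a
    small multiple of the sums of the control. The one place where the expansion
    fails is the partition interval that ends at, or straddles, a jump time
    tau; but there is only one such interval, and its term converges because
    the left limits exist.

    Both convergence statements are local, with an error proportional to the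
    increment of beta, so both are globalised by the same [sewing] lemma: the
    local estimates are additive up to a vanishing error, and Cousin's lemma
    chains them over the whole interval. *)

(** * Taylor estimates along coordinate segments *)

Lemma mean_value_bound (R : realType) (r r' : R -> R) (b c e : R) :
  0 <= b ->
  (forall z : R, 0 <= z <= b -> is_derive z 1 r (r' z)) ->
  (forall z : R, 0 <= z <= b -> `|r' z - c| <= e) ->
  `|r b - r 0 - c * b| <= e * b.
Proof.
move=> b0 dr r'c.
have [z zb rz] : exists2 z, z \in `[0, b]%R & r b - r 0 = r' z * (b - 0).
  apply: MVT_segment => // [z|].
    by rewrite in_itv/= => /andP[z0 zb]; apply: dr; rewrite !ltW.
  apply: derivable_within_continuous => z; rewrite in_itv/= => zb.
  exact: (@ex_derive _ _ _ _ _ _ _ (dr z zb)).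
move: zb; rewrite in_itv/= => zb.
rewrite rz subr0 -mulrBl normrM (ger0_norm b0).
by rewrite ler_wpM2r// r'c.
Qed.

(** Apply the mean value bound twice: first to r', then to r minus the parabola
    with second derivative c. *)
Lemma second_order_bound (R : realType) (r r' r'' : R -> R) (c e : R) :
  (forall z : R, 0 <= z <= 1 -> is_derive z 1 r (r' z)) ->
  (forall z : R, 0 <= z <= 1 -> is_derive z 1 r' (r'' z)) ->
  (forall z : R, 0 <= z <= 1 -> `|r'' z - c| <= e) ->
  `|r 1 - r 0 - r' 0 - c / 2| <= e.
Proof.
move=> dr dr' r''c.
have e0 : 0 <= e by apply: le_trans (r''c 0 _) => //; rewrite lexx ler01.
pose rho z := r z - c / 2 * z ^+ 2.
have := @mean_value_bound R rho (fun z => r' z - c * z) 1 (r' 0) e ler01.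
rewrite /rho !mulr1 expr1n expr0n/= mulr0 mulr1 subr0 => H.
have -> : r 1 - r 0 - r' 0 - c / 2 = r 1 - c / 2 - r 0 - r' 0 by ring.
apply: H => z /[dup] z01 /andP[z0 z1].
  by have ? := dr z z01; apply: is_derive_eq;
    rewrite /GRing.scale/= !mulr1; lra.
have -> : r' z - c * z - r' 0 = r' z - r' 0 - c * z by ring.
apply: le_trans (_ : e * z <= _); last by rewrite ler_piMr.
apply: (@mean_value_bound R r' r'') => // y /andP[y0 yz].
  by apply: dr'; rewrite y0 (le_trans yz).
by apply: r''c; rewrite y0 (le_trans yz).
Qed.

Lemma is_derive_line (R : realType) (V : normedModType R) (f : V -> R) (p v : V)
    (h z : R) : derivable f (p + (z * h) *: v) v ->
  is_derive z 1 (fun y => f (p + (y * h) *: v)) (h * 'D_v f (p + (z * h) *: v)).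
Proof.
move=> df.
have d1 : is_derive (z * h) 1 (fun s => f (p + s *: v))
    ('D_v f (p + (z * h) *: v)).
  have E : (fun k : R => k^-1 *: (f (p + (k%:A + z * h) *: v) -
      f (p + (z * h) *: v))) =
      (fun k => k^-1 *: (f (k *: v + (p + (z * h) *: v)) -
      f (p + (z * h) *: v))).
    apply/funext => k; congr (_ *: (f _ - _)).
    by rewrite /GRing.scale/= mulr1 -/(GRing.scale _ _) scalerDl addrCA.
  apply: DeriveDef; first by rewrite /derivable/= E.
  by rewrite /derive/= E.
rewrite mulrC.
apply: (@is_derive1_comp R (fun s => f (p + s *: v)) (fun y => y * h)) => //.
by apply: is_derive_eq; rewrite scaler0 add0r /GRing.scale/= mulr1.
Qed.

(** The vertices of the coordinate path from x to x': the first j coordinates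
    have already been moved. Consecutive vertices differ along one axis only, so
    partial derivatives suffice to estimate increments along the path. *)
Definition hybrid (R : realType) (d : nat) (x x' : 'rV[R]_d) (j : nat) :=
  \row_(k < d) if (k < j)%N then x' ord0 k else x ord0 k.

(** Boxes rather than norm balls, because the coordinate path between two points
    of a box visibly stays in it. *)
Definition in_box (R : realType) (d : nat) (x0 : 'rV[R]_d) (r : R)
    (y : 'rV[R]_d) := forall k, `|y ord0 k - x0 ord0 k| < r.

Lemma hybrid0 (R : realType) (d : nat) (x x' : 'rV[R]_d) : hybrid x x' 0 = x.
Proof. by apply/rowP => k; rewrite mxE. Qed.

Lemma hybrid_size (R : realType) (d : nat) (x x' : 'rV[R]_d) :
  hybrid x x' d = x'.
Proof. by apply/rowP => k; rewrite mxE ltn_ord. Qed.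

Lemma hybridS (R : realType) (d : nat) (x x' : 'rV[R]_d) (j : 'I_d) :
  hybrid x x' j.+1 =
  hybrid x x' j + (1 * (x' ord0 j - x ord0 j)) *: unit_row R j.
Proof.
apply/rowP => k; rewrite !mxE/= mul1r.
have [->|kj] := eqVneq k j; first by rewrite ltnn ltnSn/=; ring.
by rewrite mulr0 addr0 ltnS leq_eqVlt (negbTE (_ : val k != val j)).
Qed.

Lemma hybrid_in_box (R : realType) (d : nat) (x0 x x' : 'rV[R]_d) (r : R)
    (j : 'I_d) (z : R) : in_box x0 r x -> in_box x0 r x' -> 0 <= z <= 1 ->
  in_box x0 r
    (hybrid x x' j + (z * (x' ord0 j - x ord0 j)) *: unit_row R j).
Proof.
move=> xr xr' /andP[z0 z1] k; rewrite !mxE/=.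
have := xr k; have := xr' k.
have [->|kj] := eqVneq k j.
  rewrite ltnn mulr1; set p := x ord0 j; set q := x' ord0 j => qr pr.
  have -> : p + z * (q - p) - x0 ord0 j =
    (1 - z) * (p - x0 ord0 j) + z * (q - x0 ord0 j) by ring.
  set m := Num.max `|q - x0 ord0 j| `|p - x0 ord0 j|.
  apply: le_lt_trans (_ : m < r); last by rewrite gt_max qr pr.
  apply: le_trans (ler_normD _ _) _; rewrite !normrM (ger0_norm z0).
  rewrite (ger0_norm (_ : 0 <= 1 - z)) ?subr_ge0//.
  have qm : `|q - x0 ord0 j| <= m by rewrite le_max lexx.
  have pm : `|p - x0 ord0 j| <= m by rewrite le_max lexx orbT.
  by nra.
by rewrite mulr0 addr0; case: ifP.
Qed.

Lemma hybrid_vertex_in_box (R : realType) (d : nat) (x0 x x' : 'rV[R]_d) (r : R)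
    (j : nat) : in_box x0 r x -> in_box x0 r x' ->
  in_box x0 r (hybrid x x' j).
Proof. by move=> xr xr' k; rewrite !mxE; case: ifP. Qed.

Lemma hybrid_telescope (R : realType) (d : nat) (f : 'rV[R]_d -> R) x x' :
  f x' - f x = \sum_(j < d) (f (hybrid x x' j.+1) - f (hybrid x x' j)).
Proof.
rewrite -(big_mkord xpredT (fun j => f (hybrid x x' j.+1) - f (hybrid x x' j))).
by rewrite telescope_sumr// hybrid0 hybrid_size.
Qed.

Lemma first_order_expansion (R : realType) (d : nat) (f : 'rV[R]_d -> R)
    (x0 : 'rV[R]_d) (r e : R) (c : 'I_d -> R) :
  (forall y j, in_box x0 r y -> derivable f y (unit_row R j)) ->
  (forall y j, in_box x0 r y -> `|'D_(unit_row R j) f y - c j| <= e) ->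
  forall x x', in_box x0 r x -> in_box x0 r x' ->
  `|f x' - f x - \sum_(j < d) c j * (x' ord0 j - x ord0 j)|
    <= e * \sum_(j < d) `|x' ord0 j - x ord0 j|.
Proof.
move=> df dfc x x' xr xr'.
rewrite hybrid_telescope -sumrB mulr_sumr.
apply: le_trans (ler_norm_sum _ _ _) _; apply: ler_sum => j _.
set h := x' ord0 j - x ord0 j.
pose line z := hybrid x x' j + (z * h) *: unit_row R j.
have lineP z : 0 <= z <= 1 -> in_box x0 r (line z) by exact: hybrid_in_box.
have line0 : line 0 = hybrid x x' j by rewrite /line mul0r scale0r addr0.
have line1 : line 1 = hybrid x x' j.+1 by rewrite hybridS.
have := @mean_value_bound R (fun z => f (line z))
  (fun z => h * 'D_(unit_row R j) f (line z)) 1 (c j * h) (e * `|h|) ler01.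
rewrite /= !mulr1 line0 line1; apply => z z01.
  by apply: is_derive_line; exact/df/lineP.
by rewrite mulrC -mulrBl normrM ler_wpM2r// dfc//; exact: lineP.
Qed.

(** The quadratic form produced by walking along the coordinate path: the j-th
    step sees the mixed derivatives with the coordinates moved before j, and
    half of the pure one. When M is symmetric this is half of its quadratic
    form. *)
Definition half_hessian (R : realType) (d : nat) (M : 'I_d -> 'I_d -> R)
    (j k : 'I_d) : R :=
  if (k < j)%N then M j k else if k == j then M j k / 2 else 0.

Lemma sum_norm_sqr (R : realType) (d : nat) (h : 'I_d -> R) :
  (\sum_(j < d) `|h j|) * (\sum_(j < d) `|h j|) <=
  (2 * d)%:R * \sum_(j < d) h j ^+ 2.
Proof.
rewrite mulr_suml.
apply: le_trans (_ : \sum_(j < d) \sum_(k < d) (h j ^+ 2 + h k ^+ 2) <= _).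
  apply: ler_sum => j _; rewrite mulr_sumr; apply: ler_sum => k _.
  rewrite -(real_normK (num_real (h j))) -(real_normK (num_real (h k))).
  by have := normr_ge0 (h j); have := normr_ge0 (h k); nra.
under eq_bigr do rewrite big_split/= sumr_const card_ord.
rewrite big_split/= sumr_const card_ord -sumrMnl.
under eq_bigr do rewrite -mulr_natl.
by rewrite -mulr_sumr -mulr_natl natrM; lra.
Qed.

(** On the j-th segment of the coordinate path the one-variable estimate
    [second_order_bound] applies at the vertex where the segment starts, and
    [first_order_expansion] moves the partial derivative from that vertex back
    to x. The factor 2d + 1 comes from bounding the square of the l1 norm by the
    squared euclidean norm. *)
Lemma second_order_expansion (R : realType) (d : nat) (f : 'rV[R]_d -> R)
    (x0 : 'rV[R]_d) (r e : R) (M : 'I_d -> 'I_d -> R) :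
  (forall y j, in_box x0 r y -> derivable f y (unit_row R j)) ->
  (forall y j k, in_box x0 r y ->
    derivable ('D_(unit_row R j) f) y (unit_row R k)) ->
  (forall y j k, in_box x0 r y ->
    `|'D_(unit_row R k) ('D_(unit_row R j) f) y - M j k| <= e) ->
  forall x x', in_box x0 r x -> in_box x0 r x' ->
  `|f x' - f x
    - \sum_(j < d) 'D_(unit_row R j) f x * (x' ord0 j - x ord0 j)
    - \sum_(j < d) \sum_(k < d) half_hessian M j k *
        ((x' ord0 j - x ord0 j) * (x' ord0 k - x ord0 k))|
    <= e * ((2 * d).+1%:R * \sum_(j < d) (x' ord0 j - x ord0 j) ^+ 2).
Proof.
move=> df ddf ddfM x x' xr xr'.
pose h j := x' ord0 j - x ord0 j.
rewrite hybrid_telescope -!sumrB.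
apply: le_trans (ler_norm_sum _ _ _) _.
apply: le_trans (_ : \sum_(j < d) (e * (`|h j| * (\sum_(k < d) `|h k|))
                       + e * h j ^+ 2) <= _); last first.
  case: (pickP (@predT 'I_d)) => [j0 _|no]; last first.
    by rewrite [leLHS]big1 ?[X in _ * (_ * X)]big1 ?mulr0// => i; have := no i.
  have e0 : 0 <= e.
    by apply: le_trans (ddfM x j0 j0 xr).
  rewrite big_split/= -!mulr_sumr -mulrDr ler_wpM2l//.
  rewrite -mulr_suml -natr1 mulrDl mul1r lerD2r.
  exact: sum_norm_sqr.
apply: ler_sum => j _; rewrite -/(h j).
pose line z := hybrid x x' j + (z * h j) *: unit_row R j.
have lineP z : 0 <= z <= 1 -> in_box x0 r (line z) by exact: hybrid_in_box.
have line0 : line 0 = hybrid x x' j by rewrite /line mul0r scale0r addr0.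
have line1 : line 1 = hybrid x x' j.+1 by rewrite hybridS.
have A : `|f (hybrid x x' j.+1) - f (hybrid x x' j)
    - h j * 'D_(unit_row R j) f (hybrid x x' j) - M j j * h j ^+ 2 / 2|
    <= e * h j ^+ 2.
  have := @second_order_bound R (fun z => f (line z))
    (fun z => h j * 'D_(unit_row R j) f (line z))
    (fun z => h j * (h j * 'D_(unit_row R j) ('D_(unit_row R j) f) (line z)))
    (M j j * h j ^+ 2) (e * h j ^+ 2).
  rewrite /= line0 line1; apply => z z01.
  - by apply: is_derive_line; exact/df/lineP.
  - apply: is_deriveZ; apply: is_derive_line; exact/ddf/lineP.
  - rewrite mulrA -expr2 mulrC -mulrBl normrM (ger0_norm (sqr_ge0 _)).
    by rewrite ler_wpM2r ?sqr_ge0// ddfM//; exact: lineP.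
have B := @first_order_expansion R d ('D_(unit_row R j) f) x0 r e (M j)
  (fun y k => ddf y j k) (fun y k => ddfM y j k) x (hybrid x x' j) xr
  (hybrid_vertex_in_box j xr xr').
have e0 : 0 <= e by apply: le_trans (ddfM x j j xr).
have C : \sum_(k < d) `|hybrid x x' j ord0 k - x ord0 k| <= \sum_k `|h k|.
  apply: ler_sum => k _; rewrite mxE; case: ifP => // _.
  by rewrite subrr normr0.
have {C}B := le_trans B (ler_wpM2l e0 C).
have -> : \sum_(k < d) half_hessian M j k * (h j * h k) =
    M j j * h j ^+ 2 / 2 +
    h j * \sum_(k < d) M j k * (hybrid x x' j ord0 k - x ord0 k).
  rewrite (bigD1 j)//= [in RHS](bigD1 j)//= mxE ltnn subrr mulr0 add0r.
  congr (_ + _); first by rewrite /half_hessian ltnn eqxx; ring.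
  rewrite mulr_sumr; apply: eq_bigr => k kj.
  rewrite mxE /half_hessian (negbTE kj); case: ifP => _; last by ring.
  by rewrite /h; ring.
move: A B; set u := \sum_k _ * _; set p := \sum_k _.
set a := f _ - _; set b := 'D_ _ f _; set b0 := 'D_ _ f _ => A B.
have -> : a - b0 * h j - (M j j * h j ^+ 2 / 2 + h j * u) =
  h j * (b - b0 - u) + (a - h j * b - M j j * h j ^+ 2 / 2) by ring.
apply: le_trans (ler_normD _ _) _; apply: lerD => //.
by rewrite normrM mulrCA ler_wpM2l.
Qed.

(** * Freezing the derivatives of a function of class C12 *)

Lemma nbhs_box (R : realType) (m d : nat) (a0 : 'rV[R]_m) (x0 : 'rV[R]_d)
    (P : set ('rV[R]_m * 'rV[R]_d)) : nbhs (a0, x0) P ->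
  exists2 r : R, 0 < r &
    forall a x, in_box a0 r a -> in_box x0 r x -> P (a, x).
Proof.
move=> /nbhs_ballP[r r0 rP]; exists r => // a x ar xr; apply: rP; split => /=.
  by split => // i k; rewrite ord1 /ball/= distrC.
by split => // i k; rewrite ord1 /ball/= distrC.
Qed.

(** Move x first, with a frozen, then a. The gradient is kept at the running
    point (a, x), since it will be the integrand; the other coefficients c and Q
    are frozen at (a0, x0), so that their partition sums converge for elementary
    reasons. The price of freezing is the factor e, by continuity of the
    derivatives at (a0, x0). *)
Lemma C12_expansion (R : realType) (m d : nat)
    (U : set ('rV[R]_m * 'rV[R]_d)) (f : 'rV[R]_m -> 'rV[R]_d -> R)
    (a0 : 'rV[R]_m) (x0 : 'rV[R]_d) : open U -> C12 U f -> U (a0, x0) ->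
  exists (c : 'I_m -> R) (Q : 'I_d -> 'I_d -> R), forall e : R, 0 < e ->
  exists2 r : R, 0 < r & forall a x a' x',
    in_box a0 r a -> in_box x0 r x -> in_box a0 r a' -> in_box x0 r x' ->
    `|f a' x' - f a x - dot (grad_x f a x) (x' - x)
      - \sum_(i < m) c i * (a' ord0 i - a ord0 i)
      - \sum_(j < d) \sum_(k < d) Q j k *
          ((x' ord0 j - x ord0 j) * (x' ord0 k - x ord0 k))|
    <= e * (\sum_(i < m) `|a' ord0 i - a ord0 i| +
            \sum_(j < d) (x' ord0 j - x ord0 j) ^+ 2).
Proof.
move=> oU [fa fx fxx] U0.
pose c i := partial_a f i a0 x0; pose M j k := partial_xx f j k a0 x0.
exists c, (half_hessian M) => e e0.
(* absorbs the factor 2d + 1 of the second-order expansion *)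
pose e' := e / (2 * d).+1%:R.
have e'0 : 0 < e' by rewrite divr_gt0.
have : \forall q \near (a0, x0), [/\ U q,
    forall i, `|partial_a f i q.1 q.2 - c i| <= e' &
    forall j k, `|partial_xx f j k q.1 q.2 - M j k| <= e'].
  have near_le (g : 'rV[R]_m * 'rV[R]_d -> R) : continuous_at (a0, x0) g ->
      nbhs (a0, x0) (fun q => `|g q - g (a0, x0)| <= e').
    move=> /cvgrPdist_le/(_ _ e'0).
    by under eq_near do rewrite distrC.
  have H1 : nbhs (a0, x0) (fun q =>
      forall i, `|partial_a f i q.1 q.2 - c i| <= e').
    apply: (@filter_forall _ 'I_m (fun i q =>
      `|partial_a f i q.1 q.2 - c i| <= e') (nbhs (a0, x0)) _) => i.
    exact: near_le (fa i _ U0).2.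
  have H2 : nbhs (a0, x0) (fun q =>
      forall jk : 'I_d * 'I_d,
        `|partial_xx f jk.1 jk.2 q.1 q.2 - M jk.1 jk.2| <= e').
    apply: (@filter_forall _ ('I_d * 'I_d)%type (fun jk q =>
      `|partial_xx f jk.1 jk.2 q.1 q.2 - M jk.1 jk.2| <= e')
      (nbhs (a0, x0)) _) => jk.
    exact: near_le (fxx jk.1 jk.2 _ U0).2.
  have H3 : \forall q \near (a0, x0), U q by exact: open_nbhs_nbhs.
  apply: filterS3 H3 H1 H2 => q Uq q1 q2; split=> // j k; exact: (q2 (j, k)).
move=> /nbhs_box[r r0 rP]; exists r => // a x a' x' ar xr a'r x'r.
have A : `|f a' x' - f a x' - \sum_(i < m) c i * (a' ord0 i - a ord0 i)|
    <= e' * \sum_(i < m) `|a' ord0 i - a ord0 i|.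
  apply: (@first_order_expansion R m (fun b => f b x') a0 r) => // b i br.
    by have [Uq _ _] := rP b x' br x'r; have [] := fa i _ Uq.
  by have [_ + _] := rP b x' br x'r; exact.
have B := @second_order_expansion R d (f a) x0 r e' M.
have {}B := B _ _ _ x x' xr x'r.
have {}B := B _ _ _.
have -> : dot (grad_x f a x) (x' - x) =
    \sum_(j < d) 'D_(unit_row R j) (f a) x * (x' ord0 j - x ord0 j).
  by apply: eq_bigr => j _; rewrite !mxE.
have e'e : e' <= e.
  by rewrite ler_pdivrMr// ler_peMr ?ler1n// ltW.
have {}B : `|f a x' - f a x
    - \sum_(j < d) 'D_(unit_row R j) (f a) x * (x' ord0 j - x ord0 j)
    - \sum_(j < d) \sum_(k < d) half_hessian M j k *
        ((x' ord0 j - x ord0 j) * (x' ord0 k - x ord0 k))|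
    <= e * \sum_(j < d) (x' ord0 j - x ord0 j) ^+ 2.
  have -> : e = e' * (2 * d).+1%:R by rewrite divfK.
  rewrite -mulrA; apply: B => y j => [|k|k] yr; have [Uq _ H] := rP a y ar yr.
  - by have [] := fx j _ Uq.
  - by have [] := fxx j k _ Uq.
  - exact: H.
have {}A := le_trans A (ler_wpM2r (sumr_ge0 _ (fun i _ => normr_ge0 _)) e'e).
rewrite mulrDr; apply: le_trans (lerD A B).
apply: le_trans (ler_normD _ _); rewrite le_eqVlt; apply/orP; left; apply/eqP.
by congr `|_|; ring.
Qed.

(** * Sums of interval functions along one partition *)

(** Truncating the partition points to [s, u] is how a sum is restricted to that
    interval: the partition intervals outside it collapse to points. *)
Definition clamp (R : realType) (s u x : R) : R := Num.max s (Num.min x u).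

Section clamp.
Variables (R : realType).
Implicit Types s u v x y : R.

Lemma clamp_le s u x y : x <= y -> clamp s u x <= clamp s u y.
Proof.
move=> xy; rewrite /clamp ge_max le_max lexx/= le_max orbC le_min !ge_min lexx.
by rewrite xy orbT.
Qed.

Lemma clamp_itv s u x : s <= u -> s <= clamp s u x <= u.
Proof.
by move=> su; rewrite /clamp le_max lexx/= ge_max su ge_min lexx orbT.
Qed.

Lemma clamp_lo s u x : x <= s -> clamp s u x = s.
Proof. by move=> xs; rewrite /clamp max_l// ge_min xs. Qed.

Lemma clamp_hi s u x : s <= u -> u <= x -> clamp s u x = u.
Proof. by move=> su ux; rewrite /clamp min_r// max_r. Qed.

Lemma clamp_below s u x : x <= u -> clamp s u x = Num.max s x.
Proof. by move=> xu; rewrite /clamp min_l. Qed.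

Lemma clamp_above s u x : s <= u -> s <= x -> clamp s u x = Num.min x u.
Proof. by move=> su sx; rewrite /clamp max_r// le_min sx su. Qed.

End clamp.

Definition psum (R : realType) (p : nat -> R) (N : nat) (g : R -> R -> R)
    (s u : R) : R :=
  \sum_(i < N) g (clamp s u (p i)) (clamp s u (p i.+1)).

Section one_partition.
Variables (R : realType) (p : nat -> R) (N : nat) (T : R).
Hypotheses (p0 : p 0%N = 0) (p_lt : forall i, p i < p i.+1) (pN : T <= p N).
Implicit Types (g b : R -> R -> R) (s u v : R).

Lemma psum_telescope (F : R -> R) s u : 0 <= s -> s <= u -> u <= T ->
  psum p N (fun x y => F y - F x) s u = F u - F s.
Proof.
move=> s0 su uT.
rewrite /psum -(big_mkord xpredT
  (fun i => F (clamp s u (p i.+1)) - F (clamp s u (p i)))).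
rewrite (telescope_sumr (fun i => F (clamp s u (p i))))//.
by rewrite clamp_hi// ?(le_trans uT)// p0 clamp_lo.
Qed.

Lemma psum_norm_le g b s u : s <= u ->
  (forall x y, s <= x -> x <= y -> y <= u -> `|g x y| <= b x y) ->
  `|psum p N g s u| <= psum p N b s u.
Proof.
move=> su gb; apply: le_trans (ler_norm_sum _ _ _) _; apply: ler_sum => i _.
apply: gb.
- by case/andP: (clamp_itv (p i) su).
- exact/clamp_le/ltW.
- by case/andP: (clamp_itv (p i.+1) su).
Qed.

Lemma psum_xx g s : (forall x, g x x = 0) -> psum p N g s s = 0.
Proof.
move=> g0; apply: big1 => i _.
have clampss x : clamp s s x = s by apply/le_anti; rewrite andbC clamp_itv.
by rewrite !clampss g0.
Qed.

Lemma partition_le i j : (i <= j)%N -> p i <= p j.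
Proof.
by move=> ij; apply: (@homo_leq _ p <=%R) => // [? ? ?|?];
  [exact: le_trans|exact: ltW].
Qed.

(** Partition intervals are disjoint, so at most one of them can contain tau. *)
Lemma straddle_sum (z : nat -> R) (tau e : R) : 0 <= e ->
  (forall i, p i < tau -> tau <= p i.+1 -> `|z i| <= e) ->
  (forall i, ~~ (p i < tau <= p i.+1) -> z i = 0) ->
  `|\sum_(i < N) z i| <= e.
Proof.
move=> e0 ze z0.
case: (pickP (fun i : 'I_N => p i < tau <= p i.+1)) => [i0|no]; last first.
  by rewrite big1 ?normr0// => i _; apply: z0; rewrite no.
move=> /andP[a b].
rewrite (bigD1 i0)//= big1 ?addr0 ?ze// => i ii0; apply: z0.
apply/negP => /andP[c d].
have [ii|ii|ii] := ltngtP i i0.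
- by have := lt_le_trans (le_lt_trans (partition_le ii) a) d; rewrite ltxx.
- by have := lt_le_trans (le_lt_trans (partition_le ii) c) b; rewrite ltxx.
- by move/eqP: ii0; apply; exact: val_inj.
Qed.

(** Only the partition interval straddling u contributes to the difference, and
    its ends are within delta of u. *)
Lemma psum_split g s u v (delta e : R) : s <= u -> u <= v ->
  (forall x, g x x = 0) -> 0 <= e ->
  (forall i, p i.+1 - p i < delta) ->
  (forall x y, s <= x -> u - delta < x -> x < u ->
     y <= v -> u < y -> y < u + delta -> `|g x y - g x u - g u y| <= e) ->
  `|psum p N g s v - psum p N g s u - psum p N g u v| <= e.
Proof.
move=> su uv g0 e0 pd ge; rewrite -!sumrB.
have sv := le_trans su uv.
pose z i := g (clamp s v (p i)) (clamp s v (p i.+1)) -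
  g (clamp s u (p i)) (clamp s u (p i.+1)) -
  g (clamp u v (p i)) (clamp u v (p i.+1)).
apply: (@straddle_sum z u) => // i; rewrite /z.
- move=> pu up; rewrite (clamp_hi su up) (@clamp_lo _ u v (p i)) ?(ltW pu)//.
  rewrite (@clamp_below _ s u)// ?(ltW pu)// (@clamp_below _ s v); last first.
    exact: le_trans (ltW pu) uv.
  rewrite (@clamp_above _ s v)// ?(le_trans su)// (@clamp_above _ u v)//.
  have [su'|us] := ltP s u; last first.
    have -> : s = u by apply/le_anti; rewrite su us.
    by rewrite max_l ?(ltW pu)// g0 subr0 subrr normr0.
  move: up; rewrite le_eqVlt => /predU1P[<-|up].
    by rewrite min_l// g0 subr0 subrr normr0.
  have [->|uv'] := eqVneq v u.
    by rewrite min_r ?(ltW up)// g0 subr0 subrr normr0.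
  have := pd i => pdi.
  apply: ge.
  + by rewrite le_max lexx.
  + by rewrite lt_max orbC; apply/orP; left; lra.
  + by rewrite gt_max su' pu.
  + by rewrite ge_min lexx orbT.
  + by rewrite lt_min up/= lt_neqAle eq_sym uv' uv.
  + by rewrite gt_min; apply/orP; left; lra.
- rewrite negb_and -leNgt -ltNge => /orP[up|pu].
    have up' := le_trans up (ltW (p_lt i)).
    rewrite !(@clamp_hi _ s u)// g0 subr0.
    rewrite !(@clamp_above _ s v)// ?(le_trans su)//.
    by rewrite !(@clamp_above _ u v)// subrr.
  have pu' := lt_trans (p_lt i) pu.
  rewrite !(@clamp_lo _ u v) ?(ltW pu)// ?(ltW pu')// g0 subr0.
  rewrite !(@clamp_below _ s u) ?(ltW pu)// ?(ltW pu')//.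
  rewrite !(@clamp_below _ s v) ?subrr//.
    exact: le_trans (ltW pu) uv.
  exact: le_trans (ltW pu') uv.
Qed.

(** Exactly one truncated partition interval ends at u without being a point;
    its term is compared with l, and all the others with b. This isolates the
    term that sees a jump at u. *)
Lemma psum_last g b s u (l delta e : R) : 0 <= s -> s < u -> u <= T ->
  g u u = 0 ->
  (forall x y, s <= x -> x <= y -> y <= u -> 0 <= b x y) ->
  (forall i, p i.+1 - p i < delta) ->
  (forall x y, s <= x -> x <= y -> y < u -> `|g x y| <= b x y) ->
  (forall x, s <= x -> u - delta < x -> x < u -> `|g x u - l| <= e) ->
  `|psum p N g s u - l| <= psum p N b s u + e.
Proof.
move=> s0 su uT g0 b0 pd gb gl; have su' := ltW su.
have cit x := clamp_itv x su'.
have cmon i : clamp s u (p i) <= clamp s u (p i.+1) by exact/clamp_le/ltW.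
have cb i : 0 <= b (clamp s u (p i)) (clamp s u (p i.+1)).
  by case/andP: (cit (p i)) => ? ?; case/andP: (cit (p i.+1)) => ? ?; exact: b0.
have [j ju] : exists j : 'I_N, p j < u <= p j.+1.
  have ex : exists n, u <= p n by exists N; exact: le_trans uT pN.
  (* the first partition point at or after u *)
  case: (ex_minnP ex) => -[|n]; first by rewrite p0 leNgt (le_lt_trans s0 su).
  move=> un nmin; have nN : (n < N)%N by apply: nmin; exact: le_trans uT pN.
  exists (Ordinal nN); rewrite /= un andbT ltNge; apply/negP => /nmin.
  by rewrite ltnn.
case/andP: ju => pju upj.
rewrite /psum (bigD1 j)//= [X in _ <= X + _](bigD1 j)//=.
rewrite (clamp_hi su' upj) (@clamp_below _ s u (p j)) ?(ltW pju)//.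
have A : `|g (Num.max s (p j)) u - l| <= e.
  apply: gl; first by rewrite le_max lexx.
    by rewrite lt_max orbC; apply/orP; left; have := pd j; lra.
  by rewrite gt_max su pju.
have B : `|\sum_(i < N | i != j) g (clamp s u (p i)) (clamp s u (p i.+1))| <=
    \sum_(i < N | i != j) b (clamp s u (p i)) (clamp s u (p i.+1)).
  apply: le_trans (ler_norm_sum _ _ _) _; apply: ler_sum => i ij.
  have [ij'|ji|/val_inj ij'] := ltngtP i j; last by rewrite ij' eqxx in ij.
    apply: gb => //; first by case/andP: (cit (p i)).
    apply: le_lt_trans (_ : Num.max s (p j) < u); last by rewrite gt_max su pju.
    rewrite -(@clamp_below _ s u (p j)) ?(ltW pju)//.
    exact/clamp_le/partition_le.
  have up : u <= p i by exact/(le_trans upj)/partition_le.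
  have := cb i; rewrite !(clamp_hi su') ?g0 ?normr0//.
  exact/(le_trans up)/ltW.
have C : 0 <= b (Num.max s (p j)) u.
  apply: b0 => //; first by rewrite le_max lexx.
  by rewrite ge_max su' ltW.
rewrite addrAC; apply: le_trans (ler_normD _ _) _; lra.
Qed.

End one_partition.

(** * Sewing local estimates along a sequence of partitions *)

(** The supremum of the points reachable from a is itself reachable by the left
    half of the local hypothesis, and the right half would push it further if it
    were smaller than b. *)
Lemma cousin (R : realType) (P : R -> R -> Prop) (a b : R) : a <= b ->
  (forall s, a <= s -> s <= b -> P s s) ->
  (forall s u v, a <= s -> s <= u -> u <= v -> v <= b ->
     P s u -> P u v -> P s v) ->
  (forall tau, a <= tau -> tau <= b -> exists2 delta : R, 0 < delta &
     forall s u, s = tau \/ u = tau -> a <= s -> s < u -> u <= b ->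
       tau - delta < s -> u < tau + delta -> P s u) ->
  P a b.
Proof.
move=> ab Pxx Ptrans Ploc.
pose E := [set u | [/\ a <= u, u <= b & P a u]].
have Ea : E a by split => //; exact: Pxx.
have supE : has_sup E by split; [exists a|exists b => u []].
pose sigma := sup E.
have asig : a <= sigma by apply: ub_le_sup Ea; case: supE.
have sigb : sigma <= b by apply: ge_sup; [exists a|move=> u []].
have [delta d0 dP] := Ploc sigma asig sigb.
have Psig : P a sigma.
  have [u [au ub Pau] us] := sup_adherent d0 supE.
  have : u <= sigma by apply: ub_le_sup; [case: supE|split].
  rewrite le_eqVlt => /predU1P[<-//|usig].
  apply: (Ptrans a u sigma) => //; first exact: ltW.
  by apply: dP => //; [right|rewrite ltrDl].
move: sigb; rewrite le_eqVlt => /predU1P[<-//|sigb].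
(* a point reachable from sigma, and beyond it *)
pose w := Num.min b (sigma + delta / 2).
have sw : sigma < w by rewrite lt_min sigb/= ltrDl divr_gt0.
have wb : w <= b by rewrite ge_min lexx.
have : w <= sigma.
  apply: ub_le_sup; first by case: supE.
  split => //; first exact/(le_trans asig)/ltW.
  apply: (Ptrans a sigma w) => //; first exact: ltW.
  apply: dP => //; first by left.
    by rewrite ltrBlDr ltrDl.
  rewrite gt_min; apply/orP; right; rewrite ltrD2l; lra.
by rewrite leNgt sw.
Qed.

(** The upper limit of |x - l| is at most c. Unlike convergence, this can be
    asserted for sums with a controlled error, and the errors add up. *)
Definition close_to (R : realType) (x : nat -> R) (l c : R) :=
  forall e : R, 0 < e -> \forall n \near \oo, `|x n - l| <= c + e.

(** Inserting the point s into a small interval around it changes the sum by a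
    vanishing amount. For right continuous paths with left limits, left-point
    products c(x) (a(y) - a(x)) and squares of increments have this property,
    even when the paths jump at s. *)
Definition nearly_additive (R : realType) (T : R) (g : R -> R -> R) :=
  (forall x, g x x = 0) /\
  forall s, 0 < s -> s < T ->
    g z.1 z.2 - g z.1 s - g s z.2 @[z --> filter_prod s^'- s^'+] --> 0.

Section close_to.
Variables (R : realType).
Implicit Types (x y z : nat -> R) (l c : R).

Lemma cvg_close_to x l : x @ \oo --> l -> close_to x l 0.
Proof.
move=> /cvgrPdist_le xl e e0; rewrite add0r.
by apply: filterS (xl e e0) => n; rewrite distrC.
Qed.

Lemma close_toD x y z l l' c c' :
  z n - x n - y n @[n --> \oo] --> (0 : R) ->
  close_to x l c -> close_to y l' c' -> close_to z (l + l') (c + c').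
Proof.
move=> /cvgrPdist_le zxy xl yl e e0.
have e30 : 0 < e / 3 by rewrite divr_gt0.
apply: filterS3 (zxy _ e30) (xl _ e30) (yl _ e30) => n.
rewrite sub0r normrN => A B C.
have -> : z n - (l + l') = (z n - x n - y n) + (x n - l) + (y n - l') by ring.
apply: le_trans (ler_normD _ _) _.
by have := ler_normD (z n - x n - y n) (x n - l); lra.
Qed.

Lemma close_to_cvg0 x c : (forall e, 0 < e -> close_to x 0 (e * c)) ->
  x @ \oo --> (0 : R).
Proof.
move=> H; apply/cvgrPdist_le => e e0.
have c0 : 0 < `|c| + 1 by rewrite ltr_wpDl.
(* chosen so that its product with c is at most e / 2, whatever the sign *)
have e1 : 0 < e / 2 / (`|c| + 1) by rewrite !divr_gt0.
have e2 : 0 < e / 2 by rewrite divr_gt0.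
apply: filterS (H _ e1 _ e2) => n; rewrite subr0 sub0r normrN.
suff : e / 2 / (`|c| + 1) * c <= e / 2 by lra.
rewrite -mulrA ler_piMr ?(ltW e2)// mulrC ler_pdivrMr// mul1r.
by apply: le_trans (ler_norm _) _; rewrite lerDl.
Qed.

(** The sequence is Cauchy: its tail lies arbitrarily close to some l. *)
Lemma close_to_is_cvg x c :
  (forall e, 0 < e -> exists l, close_to x l (e * c)) -> cvgn x.
Proof.
move=> H; apply: cauchy_cvg; apply: cauchy_exP => e e0.
have c0 : 0 < `|c| + 1 by rewrite ltr_wpDl.
have e1 : 0 < e / 3 / (`|c| + 1) by rewrite !divr_gt0.
have e3 : 0 < e / 3 by rewrite divr_gt0.
have [l xl] := H _ e1; exists l.
have : \forall n \near \oo, `|x n - l| <= e / 3 / (`|c| + 1) * c + e / 3.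
  exact: xl.
apply: filterS => n; rewrite /ball/= distrC => A; apply: le_lt_trans A _.
suff : e / 3 / (`|c| + 1) * c <= e / 3 by lra.
rewrite -mulrA ler_piMr ?(ltW e3)// mulrC ler_pdivrMr// mul1r.
by apply: le_trans (ler_norm _) _; rewrite lerDl.
Qed.

End close_to.

Section sewing.
Variables (R : realType) (Pi : nat -> nat -> R) (N : nat -> nat) (T : R).
Hypotheses (Pi0 : forall n, Pi n 0%N = 0)
  (Pi_lt : forall n i, Pi n i < Pi n i.+1)
  (PiN : forall n, T <= Pi n (N n))
  (Pi_fine : forall delta, 0 < delta ->
     \forall n \near \oo, forall i, Pi n i.+1 - Pi n i < delta).
Implicit Types (g h b : R -> R -> R) (s u v : R).

Definition psums g s u (n : nat) : R := psum (Pi n) (N n) g s u.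

Lemma psums_xx g s : (forall x, g x x = 0) -> psums g s s = fun=> 0.
Proof. by move=> g0; apply/funext => n; exact: psum_xx. Qed.

Lemma psums_split g s u v : nearly_additive T g ->
  0 <= s -> s <= u -> u <= v -> v <= T ->
  psums g s v n - psums g s u n - psums g u v n @[n --> \oo] --> (0 : R).
Proof.
move=> [g0 gd] s0 su uv vT.
move: su; rewrite le_eqVlt => /predU1P[<-|su].
  rewrite (psums_xx s g0); under eq_fun do rewrite subr0 subrr.
  exact: cvg_cst.
move: uv; rewrite le_eqVlt => /predU1P[<-|uv].
  rewrite (psums_xx u g0); under eq_fun do rewrite subrr subr0.
  exact: cvg_cst.
apply/cvgrPdist_le => e e0.
have [d d0 dg] : exists2 d, 0 < d & forall x y, u - d < x -> x < u -> u < y ->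
    y < u + d -> `|g x y - g x u - g u y| <= e.
  have /cvgrPdist_le/(_ _ e0) := gd u (le_lt_trans s0 su) (lt_le_trans uv vT).
  move=> [[B C]/= [[d d0 dB] [d' d'0 dC]] BC].
  exists (Num.min d d'); first by rewrite lt_min d0.
  move=> x y ux xu uy yu; have := BC (x, y); rewrite /= sub0r normrN; apply.
  have dd : Num.min d d' <= d by rewrite ge_min lexx.
  have dd' : Num.min d d' <= d' by rewrite ge_min lexx orbT.
  by split; [apply: dB|apply: dC] => //=;
    [rewrite ger0_norm|rewrite ler0_norm]; lra.
apply: filterS (Pi_fine d0) => n nd.
rewrite sub0r normrN /psums.
apply: (@psum_split _ _ (N n) (Pi_lt n) g s u v d e) => //.
- exact: ltW.
- exact: ltW.
- exact: ltW.
- by move=> x y _ ? ? _ ? ?; exact: dg.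
Qed.

Lemma psums_cvg_sub g s u ls lu : nearly_additive T g ->
  0 <= s -> s <= u -> u <= T ->
  psums g 0 s @ \oo --> ls -> psums g 0 u @ \oo --> lu ->
  psums g s u @ \oo --> lu - ls.
Proof.
move=> gna s0 su uT gs gu.
have H := psums_split gna (lexx 0) s0 su uT.
have -> : psums g s u = fun n => psums g 0 u n - psums g 0 s n -
    (psums g 0 u n - psums g 0 s n - psums g s u n).
  by apply/funext => n; rewrite subKr.
by rewrite -[lu - ls]subr0; apply: cvgB => //; exact: cvgB.
Qed.

Lemma psums_close g h b s u l (B e : R) : s <= u ->
  (forall x y, s <= x -> x <= y -> y <= u -> `|g x y - h x y| <= e * b x y) ->
  psums h s u @ \oo --> l -> psums b s u @ \oo --> B ->
  close_to (psums g s u) l (e * B).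
Proof.
move=> su ghb hl bB.
have A : psums (fun x y => e * b x y) s u @ \oo --> e * B.
  rewrite [X in X @ _](_ : _ = fun n => e * psums b s u n); last first.
    by apply/funext => n; rewrite /psums /psum mulr_sumr.
  exact: cvgMr.
move=> eps eps0; have e20 : 0 < eps / 2 by rewrite divr_gt0.
move/cvgrPdist_le in hl; move/cvgrPdist_le in A.
apply: filterS2 (hl _ e20) (A _ e20) => n hn An.
have : `|psums g s u n - psums h s u n| <= psums (fun x y => e * b x y) s u n.
  rewrite /psums /psum -sumrB.
  exact: (@psum_norm_le _ _ (N n) (Pi_lt n)
    (fun x y => g x y - h x y) _ s u su ghb).
move: hn An; rewrite !ler_norml => /andP[? ?] /andP[? ?] /andP[? ?].
by apply/andP; split; lra.
Qed.

(** The comparison of g with h is only available on intervals that stop before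
    u. The interval ending at u contributes the extra limit l', which is the
    jump contribution. *)
Lemma psums_close_left g h b s u l l' (B e : R) : 0 <= s -> s < u -> u <= T ->
  0 <= e -> g u u = 0 -> h u u = 0 ->
  (forall x y, s <= x -> x <= y -> y <= u -> 0 <= b x y) ->
  (forall x y, s <= x -> x <= y -> y < u -> `|g x y - h x y| <= e * b x y) ->
  g x u - h x u @[x --> u^'-] --> l' ->
  psums h s u @ \oo --> l -> psums b s u @ \oo --> B ->
  close_to (psums g s u) (l + l') (e * B).
Proof.
move=> s0 su uT e0 gu hu b0 ghb ghl hl bB.
have A : psums (fun x y => e * b x y) s u @ \oo --> e * B.
  rewrite [X in X @ _](_ : _ = fun n => e * psums b s u n); last first.
    by apply/funext => n; rewrite /psums /psum mulr_sumr.
  exact: cvgMr.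
move=> eps eps0; have e30 : 0 < eps / 3 by rewrite divr_gt0.
move/cvgrPdist_le in hl; move/cvgrPdist_le in A.
have [d d0 dP] : exists2 d, 0 < d &
    forall x, u - d < x -> x < u -> `|g x u - h x u - l'| <= eps / 3.
  move/cvgrPdist_le : ghl => /(_ _ e30)[d/= d0 dP]; exists d => // x ux xu.
  by rewrite distrC; apply: dP => //=; rewrite ger0_norm; lra.
apply: filterS3 (hl _ e30) (A _ e30) (Pi_fine d0) => n hn An nd.
have : `|psums g s u n - psums h s u n - l'| <=
    psums (fun x y => e * b x y) s u n + eps / 3.
  rewrite {1 2}/psums /psum -sumrB.
  apply: (@psum_last _ _ _ _ (Pi0 n) (Pi_lt n) (PiN n)
    (fun x y => g x y - h x y) (fun x y => e * b x y) s u l' d (eps / 3)) => //.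
  - by rewrite gu hu subrr.
  - by move=> x y ? ? ?; rewrite mulr_ge0// b0.
  - by move=> x _; exact: dP.
move: hn An; rewrite !ler_norml => /andP[? ?] /andP[? ?] /andP[? ?].
by apply/andP; split; lra.
Qed.

(** The approximate limit of the sums over [s, v] with error e (beta v - beta s)
    is additive in the interval, the defect of g being negligible; so Cousin's
    lemma applies. The set Lam of allowed limits lets the same statement produce
    both existence of a limit (all reals) and convergence to 0 (only 0). *)
Lemma sewing (Lam : set R) g (beta : R -> R) u : nearly_additive T g ->
  Lam 0 -> (forall l l', Lam l -> Lam l' -> Lam (l + l')) ->
  0 <= u -> u <= T ->
  (forall e tau, 0 < e -> 0 <= tau -> tau <= T ->
     exists2 delta, 0 < delta & forall s v, s = tau \/ v = tau ->
       0 <= s -> s < v -> v <= T -> tau - delta < s -> v < tau + delta ->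
       exists2 l, Lam l & close_to (psums g s v) l (e * (beta v - beta s))) ->
  forall e, 0 < e ->
    exists2 l, Lam l & close_to (psums g 0 u) l (e * (beta u - beta 0)).
Proof.
move=> gna Lam0 LamD u0 uT loc e e0.
apply: (@cousin R (fun s v =>
  exists2 l, Lam l & close_to (psums g s v) l (e * (beta v - beta s)))) => //.
- move=> s _ _; exists 0 => //; rewrite subrr mulr0 psums_xx; last exact: gna.1.
  by apply: cvg_close_to; exact: cvg_cst.
- move=> s v w s0 sv vw wu [l Ll gl] [l' Ll' gl'].
  exists (l + l'); first exact: LamD.
  have -> : e * (beta w - beta s) =
    e * (beta v - beta s) + e * (beta w - beta v) by ring.
  by apply: close_toD gl gl'; apply: psums_split => //; exact: le_trans uT.
- move=> tau tau0 tauu; have tauT := le_trans tauu uT.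
  have [d d0 dP] := loc e tau e0 tau0 tauT.
  exists d => // s v sv s0 sltv vu ? ?; apply: dP => //.
  exact: le_trans uT.
Qed.

End sewing.

(** * Calculus of nearly additive interval functions and their sums *)

Lemma cvg_sumr (R : realType) (I : finType) (S : Type) (F : set_system S)
    (FF : Filter F) (f : I -> S -> R) (l : I -> R) :
  (forall i, f i @ F --> l i) -> \sum_i f i x @[x --> F] --> \sum_i l i.
Proof.
move=> fl; elim: (index_enum I) => [|i s IH].
  by rewrite big_nil; under eq_fun do rewrite big_nil; exact: cvg_cst.
rewrite big_cons; under eq_fun do rewrite big_cons.
by apply: cvgD.
Qed.

Lemma cvg_sumr0 (R : realType) (I : finType) (S : Type) (F : set_system S)
    (FF : Filter F) (f : I -> S -> R) :
  (forall i, f i @ F --> (0 : R)) -> \sum_i f i x @[x --> F] --> (0 : R).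
Proof. by move=> /cvg_sumr; rewrite big1. Qed.

Lemma squeeze0 (R : realType) (S : Type) (F : set_system S) (FF : Filter F)
    (f b : S -> R) : (\forall x \near F, `|f x| <= b x) -> b @ F --> (0 : R) ->
  f @ F --> (0 : R).
Proof.
move=> fb b0; apply: (squeeze_cvgr (f := fun x => - b x) (h := b)) => //.
  by apply: filterS fb => x; rewrite ler_norml.
by rewrite -oppr0; exact: cvgN.
Qed.

Section nearly_additive.
Variables (R : realType) (T : R).
Implicit Types (g h : R -> R -> R) (a b c : R -> R).

Lemma nearly_additiveB g h : nearly_additive T g -> nearly_additive T h ->
  nearly_additive T (fun x y => g x y - h x y).
Proof.
move=> [g0 gd] [h0 hd]; split=> [x|s s0 sT]; first by rewrite g0 h0 subrr.
rewrite -[0]subr0.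
under eq_fun => z.
  rewrite (_ : _ - _ = (g z.1 z.2 - g z.1 s - g s z.2) -
    (h z.1 z.2 - h z.1 s - h s z.2)); last by ring.
  over.
by apply: cvgB; [exact: gd|exact: hd].
Qed.

Lemma nearly_additive_sum (I : finType) (g : I -> R -> R -> R) :
  (forall i, nearly_additive T (g i)) ->
  nearly_additive T (fun x y => \sum_i g i x y).
Proof.
move=> gna; split=> [x|s s0 sT].
  by rewrite big1// => i _; rewrite (gna i).1.
have H := @cvg_sumr0 _ _ _ (filter_prod s^'- s^'+) _
  (fun i z => g i z.1 z.2 - g i z.1 s - g i s z.2)
  (fun i => (gna i).2 s s0 sT).
under eq_fun do rewrite -!sumrB.
exact: H.
Qed.

Lemma nearly_additive_diff a : nearly_additive T (fun x y => a y - a x).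
Proof.
split=> [x|s s0 sT]; first by rewrite subrr.
under eq_fun => z.
  rewrite (_ : _ - _ = 0); last by ring.
  over.
exact: cvg_cst.
Qed.

(** The defect of the product is c times the defect of g, plus the jump of c
    times a value of g on a shrinking right neighbourhood. *)
Lemma nearly_additive_mulr c g : nearly_additive T g ->
  (forall s, 0 < s -> s < T -> cvg (c x @[x --> s^'-])) ->
  (forall s, 0 < s -> s < T -> g s y @[y --> s^'+] --> (0 : R)) ->
  nearly_additive T (fun x y => c x * g x y).
Proof.
move=> [g0 gd] cl gr; split=> [x|s s0 sT]; first by rewrite g0 mulr0.
have c1 : c z.1 @[z --> filter_prod s^'- s^'+] --> lim (c x @[x --> s^'-]).
  by apply: cvg_comp (cl s s0 sT); exact: cvg_fst.
have g2 : g s z.2 @[z --> filter_prod s^'- s^'+] --> (0 : R).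
  by apply: cvg_comp (gr s s0 sT); exact: cvg_snd.
under eq_fun => z.
  rewrite (_ : _ - _ = c z.1 * (g z.1 z.2 - g z.1 s - g s z.2) +
    (c z.1 - c s) * g s z.2); last by ring.
  over.
rewrite -[0]addr0; apply: cvgD.
  rewrite -[0](mulr0 (lim (c x @[x --> s^'-]))).
  by apply: cvgM => //; exact: gd.
rewrite -[0](mulr0 (lim (c x @[x --> s^'-]) - c s)).
by apply: cvgM => //; apply: cvgB => //; exact: cvg_cst.
Qed.

(** The defect is twice the product of the increments on the two sides of s, of
    which the right one tends to 0. *)
Lemma nearly_additive_sqr a :
  (forall s, 0 < s -> s < T -> a x @[x --> s^'+] --> a s) ->
  (forall s, 0 < s -> s < T -> cvg (a x @[x --> s^'-])) ->
  nearly_additive T (fun x y => (a y - a x) ^+ 2).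
Proof.
move=> ar al; split=> [x|s s0 sT]; first by rewrite subrr expr0n.
have a1 : a z.1 @[z --> filter_prod s^'- s^'+] --> lim (a x @[x --> s^'-]).
  by apply: cvg_comp (al s s0 sT); exact: cvg_fst.
have a2 : a z.2 - a s @[z --> filter_prod s^'- s^'+] --> (0 : R).
  rewrite -(subrr (a s)); apply: cvgB; last exact: cvg_cst.
  by apply: cvg_comp (ar s s0 sT); exact: cvg_snd.
under eq_fun => z.
  rewrite (_ : _ - _ = 2 * (a s - a z.1) * (a z.2 - a s)); last by ring.
  over.
rewrite -[0](mulr0 (2 * (a s - lim (a x @[x --> s^'-])))).
apply: cvgM => //; apply: cvgMr.
by apply: cvgB => //; exact: cvg_cst.
Qed.

End nearly_additive.

Section partition_limits.
Variables (R : realType) (Pi : nat -> nat -> R) (N : nat -> nat) (T : R).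
Hypotheses (Pi0 : forall n, Pi n 0%N = 0)
  (Pi_lt : forall n i, Pi n i < Pi n i.+1)
  (PiN : forall n, T <= Pi n (N n)).
Implicit Types (g h b : R -> R -> R) (s u v : R).

(** The intervals beyond u are truncated to points, so the series is eventually
    constant. *)
Lemma series_psum (p : nat -> R) (M : nat) g u : p 0%N = 0 ->
  (forall i, p i < p i.+1) -> 0 <= u -> u <= p M -> (forall x, g x x = 0) ->
  limn (series (fun i => g (Num.min (p i) u) (Num.min (p i.+1) u))) =
  psum p M g 0 u.
Proof.
move=> p0 p_lt u0 uM g0.
have p_le := partition_le p_lt.
have p_ge0 i : 0 <= p i by rewrite -p0; exact: p_le.
have E : psum p M g 0 u =
    series (fun i => g (Num.min (p i) u) (Num.min (p i.+1) u)) M.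
  rewrite /series/= big_mkord; apply: eq_bigr => i _.
  by rewrite !clamp_above.
apply: cvg_lim => //; rewrite E; apply: cvg_near_cst; exists M => // n /= Mn.
rewrite /series/= (big_cat_nat _ Mn)//= [X in _ + X]big_nat_cond.
rewrite [X in _ + X]big1 ?addr0// => i; rewrite andbT => /andP[Mi _].
by rewrite !min_r ?g0//; apply: (le_trans uM); apply: p_le => //; exact: leqW.
Qed.

Lemma qv_sum_psums (a : R -> R) u n : 0 <= u -> u <= T ->
  qv_sum (Pi n) a u = psums Pi N (fun x y => (a y - a x) ^+ 2) 0 u n.
Proof.
move=> u0 uT; rewrite /psums -(@series_psum (Pi n) (N n) _ u (Pi0 n)
  (Pi_lt n) u0 (le_trans uT (PiN n)))//.
by move=> x; rewrite subrr expr0n.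
Qed.

Lemma riemann_sum_psums d (xi X : R -> 'rV[R]_d) u n : 0 <= u -> u <= T ->
  riemann_sum (Pi n) xi X u =
  psums Pi N (fun x y => dot (xi x) (X y - X x)) 0 u n.
Proof.
move=> u0 uT; rewrite /psums -(@series_psum (Pi n) (N n) _ u (Pi0 n)
  (Pi_lt n) u0 (le_trans uT (PiN n)))//.
  rewrite /riemann_sum; congr (limn (series _)); apply/funext => i.
  have [//|upi] := leP (Pi n i) u.
  rewrite min_r; last exact/(le_trans (ltW upi))/ltW/Pi_lt.
  by rewrite subrr /dot !big1// => j _; rewrite mxE mulr0.
by move=> x; rewrite subrr /dot big1// => j _; rewrite mxE mulr0.
Qed.

Lemma psums_telescope (F : R -> R) s u : 0 <= s -> s <= u -> u <= T ->
  psums Pi N (fun x y => F y - F x) s u @ \oo --> F u - F s.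
Proof.
move=> s0 su uT; rewrite [X in X @ _](_ : _ = fun=> F u - F s).
  exact: cvg_cst.
by apply/funext => n; exact: psum_telescope.
Qed.

Lemma psums_cvgB g h s u l l' : psums Pi N g s u @ \oo --> l ->
  psums Pi N h s u @ \oo --> l' ->
  psums Pi N (fun x y => g x y - h x y) s u @ \oo --> l - l'.
Proof.
move=> gl hl.
rewrite [X in X @ _](_ : _ = fun n => psums Pi N g s u n - psums Pi N h s u n).
  exact: cvgB.
by apply/funext => n; rewrite /psums /psum -sumrB.
Qed.

Lemma psums_cvgZ g (c : R) s u l : psums Pi N g s u @ \oo --> l ->
  psums Pi N (fun x y => c * g x y) s u @ \oo --> c * l.
Proof.
move=> gl; rewrite [X in X @ _](_ : _ = fun n => c * psums Pi N g s u n).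
  exact: cvgMr.
by apply/funext => n; rewrite /psums /psum mulr_sumr.
Qed.

Lemma psums_cvg_sum (I : finType) (g : I -> R -> R -> R) s u (l : I -> R) :
  (forall i, psums Pi N (g i) s u @ \oo --> l i) ->
  psums Pi N (fun x y => \sum_i g i x y) s u @ \oo --> \sum_i l i.
Proof.
move=> gl; rewrite [X in X @ _](_ : _ = fun n => \sum_i psums Pi N (g i) s u n).
  exact: cvg_sumr.
by apply/funext => n; rewrite /psums /psum exchange_big.
Qed.

End partition_limits.

(** * One-sided limits, variation and quadratic variation *)

Section one_sided.
Variables (R : realType) (P : R -> Prop) (tau : R).

Lemma at_right_ex : (\forall x \near tau^'+, P x) ->
  exists2 delta : R, 0 < delta & forall x, tau < x -> x < tau + delta -> P x.
Proof.
move=> [d/= d0 dP]; exists d => // x tx xd; apply: dP => //=.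
by rewrite ler0_norm; lra.
Qed.

Lemma at_left_ex : (\forall x \near tau^'-, P x) ->
  exists2 delta : R, 0 < delta & forall x, tau - delta < x -> x < tau -> P x.
Proof.
move=> [d/= d0 dP]; exists d => // x tx xd; apply: dP => //=.
by rewrite ger0_norm; lra.
Qed.

End one_sided.

Section coordinates.
Variables (R : realType) (d : nat) (x : R -> 'rV[R]_d).
Hypothesis xc : cadlag x.

Lemma coord_right j t : 0 <= t -> x s ord0 j @[s --> t^'+] --> x t ord0 j.
Proof.
move=> t0; apply: (@cvg_comp _ _ _ x (fun M => M ord0 j) _ _ _ (xc.1 t t0)).
exact: (@coord_continuous R 1 d ord0 j (x t)).
Qed.

Lemma coord_left t : 0 < t -> exists l : 'rV[R]_d,
  forall j, x s ord0 j @[s --> t^'-] --> l ord0 j.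
Proof.
move=> t0; have [l xl] := xc.2 t t0; exists l => j.
apply: (@cvg_comp _ _ _ x (fun M => M ord0 j) _ _ _ xl).
exact: (@coord_continuous R 1 d ord0 j l).
Qed.

End coordinates.

Lemma near_in_box (R : realType) (d : nat) (F : set_system R) (FF : Filter F)
    (x : R -> 'rV[R]_d) (l : 'rV[R]_d) (r : R) : 0 < r ->
  (forall j, x s ord0 j @[s --> F] --> l ord0 j) ->
  \forall s \near F, in_box l r (x s).
Proof.
move=> r0 xl.
apply: (@filter_forall _ 'I_d (fun j s => `|x s ord0 j - l ord0 j| < r) F FF).
move=> j; have /cvgrPdist_lt/(_ _ r0) := xl j.
by apply: filterS => s; rewrite distrC.
Qed.

Lemma in_box_center (R : realType) (d : nat) (x : 'rV[R]_d) (r : R) :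
  0 < r -> in_box x r x.
Proof. by move=> r0 j; rewrite subrr normr0. Qed.

Section variation.
Variables (R : realType) (a : R -> R).
Hypothesis a_FV : FV_loc a.

Definition variation_upto (u : R) : R := fine (total_variation 0 u a).

Lemma variation_increment v w : 0 <= v -> v <= w ->
  `|a w - a v| <= variation_upto w - variation_upto v.
Proof.
move=> v0 vw; have w0 := le_trans v0 vw.
have fin s : 0 <= s -> total_variation 0 s a \is a fin_num.
  by move=> s0; apply/bounded_variationP => //; exact: a_FV.2.
have D := total_variationD a v0 vw.
have finvw : total_variation v w a \is a fin_num.
  have := fin w w0; rewrite D fin_numD => /andP[_ //].
rewrite /variation_upto D fineD ?fin// addrAC subrr add0r -lee_fin fineK//.
exact: total_variation_ge.
Qed.

Lemma variation_right_continuous s : 0 <= s ->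
  variation_upto u @[u --> s^'+] --> variation_upto s.
Proof.
move=> s0; have s1 : s < s + 1 by rewrite ltrDl.
apply: (@total_variation_right_continuous R 0 (s + 1) s a s0 s1).
  exact: a_FV.1.1.
by apply: a_FV.2; rewrite addr_ge0.
Qed.

End variation.

Section quadratic_variation.
Variables (R : realType) (Pi : nat -> nat -> R) (N : nat -> nat) (T : R).
Hypotheses (Pi0 : forall n, Pi n 0%N = 0)
  (Pi_lt : forall n i, Pi n i < Pi n i.+1)
  (PiN : forall n, T <= Pi n (N n))
  (Pi_fine : forall delta, 0 < delta ->
     \forall n \near \oo, forall i, Pi n i.+1 - Pi n i < delta).
Variables (d : nat) (X : R -> 'rV[R]_d).
Hypothesis X_QV : QV Pi X.

(** The hypothesis with i = j concerns twice the coordinate: divide by 4. *)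
Lemma QV_square : exists q : 'I_d -> R -> R,
  [/\ forall j s u, 0 <= s -> s <= u -> u <= T ->
        psums Pi N (fun x y => (X y ord0 j - X x ord0 j) ^+ 2) s u @ \oo -->
          q j u - q j s,
      forall j s, 0 <= s -> q j u @[u --> s^'+] --> q j s &
      forall j s u, 0 <= s -> s <= u -> q j s <= q j u].
Proof.
have /choice[q qP] : forall j, exists q : R -> R,
  [/\ forall s u, 0 <= s -> s <= u -> u <= T ->
        psums Pi N (fun x y => (X y ord0 j - X x ord0 j) ^+ 2) s u @ \oo -->
          q u - q s,
      forall s, 0 <= s -> q u @[u --> s^'+] --> q s &
      forall s u, 0 <= s -> s <= u -> q s <= q u].
  move=> j; have [_ [Q [QQ Qc Qh _]]] := X_QV.2 j j.
  have xc := X_QV.1.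
  exists (fun u => Q u / 4); split=> [s u s0 su uT|s s0|s u s0 su].
  - have H v : 0 <= v -> v <= T ->
        psums Pi N (fun x y => (X y ord0 j - X x ord0 j) ^+ 2) 0 v @ \oo -->
        Q v / 4.
      move=> v0 vT; rewrite [X in X @ _](_ : _ = fun n =>
        qv_sum (Pi n) (fun t => X t ord0 j + X t ord0 j) v / 4).
        by apply: cvgMl; exact: QQ.
      apply/funext => n; rewrite (qv_sum_psums Pi0 Pi_lt PiN)//.
      rewrite /psums /psum mulr_suml; apply: eq_bigr => i _.
      by set p := X _ _ _; set r := X _ _ _; field.
    apply: (psums_cvg_sub Pi_lt Pi_fine (T := T)) => //; last first.
    + by apply: H => //; exact: le_trans su.
    + by apply: H => //; exact: le_trans uT.
    apply: nearly_additive_sqr => v v0 _.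
      exact/(coord_right xc)/ltW.
    by have [l lP] := coord_left xc v0; apply/cvg_ex; exists (l ord0 j).
  - by apply: cvgMl; exact: Qc.1.
  - rewrite ler_pM2r// Qh// ?in_itv/= ?andbT//; exact: le_trans su.
by exists q; split=> j; have [] := qP j.
Qed.

(** Polarisation. *)
Lemma QV_product j k s u : 0 <= s -> s <= u -> u <= T -> exists l : R,
  psums Pi N (fun x y => (X y ord0 j - X x ord0 j) *
                        (X y ord0 k - X x ord0 k)) s u @ \oo --> l.
Proof.
move=> s0 su uT; have [_ [Q [QQ _ _ _]]] := X_QV.2 j k.
have xc := X_QV.1.
have [q [qj _ _]] := QV_square.
have H : psums Pi N (fun x y => ((X y ord0 j + X y ord0 k) -
    (X x ord0 j + X x ord0 k)) ^+ 2) s u @ \oo --> Q u - Q s.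
  have H v : 0 <= v -> v <= T ->
      psums Pi N (fun x y => ((X y ord0 j + X y ord0 k) -
        (X x ord0 j + X x ord0 k)) ^+ 2) 0 v @ \oo --> Q v.
    move=> v0 vT; rewrite [X in X @ _](_ : _ = fun n =>
      qv_sum (Pi n) (fun t => X t ord0 j + X t ord0 k) v); first exact: QQ.
    by apply/funext => n; rewrite (qv_sum_psums Pi0 Pi_lt PiN).
  apply: (psums_cvg_sub Pi_lt Pi_fine (T := T)) => //; last first.
  - by apply: H => //; exact: le_trans su.
  - by apply: H => //; exact: le_trans uT.
  apply: (nearly_additive_sqr
    (a := fun t => X t ord0 j + X t ord0 k)) => v v0 _.
    by apply: cvgD; exact/(coord_right xc)/ltW.
  have [l lP] := coord_left xc v0; apply/cvg_ex.
  by exists (l ord0 j + l ord0 k); exact: cvgD.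
exists (1 / 2 * (Q u - Q s - (q j u - q j s) - (q k u - q k s))).
rewrite [X in X @ _](_ : _ = psums Pi N (fun x y => 1 / 2 *
  (((X y ord0 j + X y ord0 k) - (X x ord0 j + X x ord0 k)) ^+ 2 -
  (X y ord0 j - X x ord0 j) ^+ 2 - (X y ord0 k - X x ord0 k) ^+ 2)) s u).
  by apply: psums_cvgZ; apply: psums_cvgB; [apply: psums_cvgB|]; rewrite ?qj//;
    exact: qj.
apply/funext => n; rewrite /psums /psum; apply: eq_bigr => i _.
by set a := X _ _ _; set b := X _ _ _; set a' := X _ _ _;
  set b' := X _ _ _; field.
Qed.

End quadratic_variation.

(** * Local Ito expansions of admissible integrands *)

(** The error term of the expansions. It dominates the l1 increment of A plus
    the squared increment of X, and the variation makes its first part exactly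
    additive. *)
Definition control (R : realType) (m d : nat) (A : R -> 'rV[R]_m)
    (X : R -> 'rV[R]_d) (v w : R) : R :=
  \sum_(i < m) (variation_upto (fun t => A t ord0 i) w -
                variation_upto (fun t => A t ord0 i) v) +
  \sum_(j < d) (X w ord0 j - X v ord0 j) ^+ 2.

(** The comparison function for the left-point increments near a given time. Its
    coefficients are constants, so its partition sums converge by telescoping
    and by the existence of covariations. *)
Definition ito_model (R : realType) (m d : nat) (A : R -> 'rV[R]_m)
    (X : R -> 'rV[R]_d) (F : R -> R) (c : 'I_m -> R) (Q : 'I_d -> 'I_d -> R)
    (v w : R) : R :=
  F w - F v
  - \sum_(i < m) c i * (A w ord0 i - A v ord0 i)
  - \sum_(j < d) \sum_(k < d) Q j k *
      ((X w ord0 j - X v ord0 j) * (X w ord0 k - X v ord0 k)).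

Definition increment (R : realType) (d : nat) (xi X : R -> 'rV[R]_d)
    (v w : R) : R := dot (xi v) (X w - X v).

(** On the left of tau the estimate stops before tau, where a jump may spoil it;
    instead the error on intervals ending at tau has a limit. *)
Definition ito_expansion (R : realType) (m d : nat) (A : R -> 'rV[R]_m)
    (X xi : R -> 'rV[R]_d) (F : R -> R) (T : R) : Prop :=
  forall tau, 0 <= tau -> tau <= T ->
  (exists c Q, forall e, 0 < e -> exists2 delta, 0 < delta &
     forall v w, tau <= v -> v <= w -> w < tau + delta -> w <= T ->
       `|increment xi X v w - ito_model A X F c Q v w| <= e * control A X v w)
  /\
  (0 < tau -> exists c Q,
     cvg (increment xi X v tau - ito_model A X F c Q v tau @[v --> tau^'-]) /\
     forall e, 0 < e -> exists2 delta, 0 < delta &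
     forall v w, tau - delta < v -> 0 <= v -> v <= w -> w < tau ->
       `|increment xi X v w - ito_model A X F c Q v w| <= e * control A X v w).

Lemma incrementE (R : realType) (d : nat) (xi X : R -> 'rV[R]_d) (v w : R) :
  increment xi X v w = \sum_(j < d) xi v ord0 j * (X w ord0 j - X v ord0 j).
Proof. by apply: eq_bigr => j _; rewrite !mxE. Qed.

Lemma increment_cvg_left (R : realType) (d : nat) (xi X : R -> 'rV[R]_d)
    (tau : R) : cadlag xi -> cadlag X -> 0 < tau ->
  cvg (increment xi X v tau @[v --> tau^'-]).
Proof.
move=> xic Xc tau0.
have [l xl] := coord_left xic tau0; have [x0 Xx] := coord_left Xc tau0.
under eq_fun do rewrite incrementE.
apply/cvg_ex; exists (\sum_j l ord0 j * (X tau ord0 j - x0 ord0 j)).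
apply: (@cvg_sumr _ _ _ _ _
  (fun j v => xi v ord0 j * (X tau ord0 j - X v ord0 j))) => j.
by apply: cvgM; [exact: xl|apply: cvgB; [exact: cvg_cst|exact: Xx]].
Qed.

Section control.
Variables (R : realType) (m d : nat) (A : R -> 'rV[R]_m) (X : R -> 'rV[R]_d).
Hypothesis A_FV : forall i, FV_loc (fun t => A t ord0 i).

Lemma le_control v w : 0 <= v -> v <= w ->
  \sum_(i < m) `|A w ord0 i - A v ord0 i| +
  \sum_(j < d) (X w ord0 j - X v ord0 j) ^+ 2 <= control A X v w.
Proof.
move=> v0 vw; rewrite lerD2r; apply: ler_sum => i _.
exact: (@variation_increment R (fun t => A t ord0 i)).
Qed.

Lemma control_ge0 v w : 0 <= v -> v <= w -> 0 <= control A X v w.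
Proof.
move=> v0 vw; apply: le_trans (le_control v0 vw).
by rewrite addr_ge0// sumr_ge0// => j _; rewrite sqr_ge0.
Qed.

Lemma norm_le_control_A i v w : 0 <= v -> v <= w ->
  `|A w ord0 i - A v ord0 i| <= control A X v w.
Proof.
move=> v0 vw; apply: le_trans (le_control v0 vw).
rewrite (bigD1 i)//= -addrA lerDl addr_ge0// ?sumr_ge0// => j _.
exact: sqr_ge0.
Qed.

Lemma norm_le_control_X j k v w : 0 <= v -> v <= w ->
  `|(X w ord0 j - X v ord0 j) * (X w ord0 k - X v ord0 k)| <= control A X v w.
Proof.
move=> v0 vw.
have sq i : (X w ord0 i - X v ord0 i) ^+ 2 <= control A X v w.
  apply: le_trans (le_control v0 vw).
  rewrite [X in _ <= _ + X](bigD1 i)//= addrCA lerDl addr_ge0// ?sumr_ge0//.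
  by move=> l _; exact: sqr_ge0.
have := sq j; have := sq k.
set p := X w _ _ - _; set q := X w _ _ - _ => ? ?.
by rewrite ler_norml; apply/andP; split; nra.
Qed.

Lemma ito_model_bound (F : R -> R) c Q : exists2 C : R, 0 <= C &
  forall v w, 0 <= v -> v <= w ->
    `|F w - F v - ito_model A X F c Q v w| <= C * control A X v w.
Proof.
exists (\sum_(i < m) `|c i| + \sum_(j < d) \sum_(k < d) `|Q j k|).
  by rewrite addr_ge0// sumr_ge0// => j _; rewrite sumr_ge0.
move=> v w v0 vw.
have -> : F w - F v - ito_model A X F c Q v w =
  \sum_(i < m) c i * (A w ord0 i - A v ord0 i) +
  \sum_(j < d) \sum_(k < d) Q j k *
      ((X w ord0 j - X v ord0 j) * (X w ord0 k - X v ord0 k)).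
  by rewrite /ito_model; ring.
apply: le_trans (ler_normD _ _) _; rewrite mulrDl !mulr_suml; apply: lerD.
  apply: le_trans (ler_norm_sum _ _ _) _; apply: ler_sum => i _.
  by rewrite normrM ler_wpM2l// norm_le_control_A.
apply: le_trans (ler_norm_sum _ _ _) _; apply: ler_sum => j _.
rewrite mulr_suml.
apply: le_trans (ler_norm_sum _ _ _) _; apply: ler_sum => k _.
by rewrite normrM ler_wpM2l// norm_le_control_X.
Qed.

End control.

Section admissible_expansion.
Variables (R : realType) (T : R) (m d : nat).
Variables (A : R -> 'rV[R]_m) (X xi : R -> 'rV[R]_d).
Variables (U : set ('rV[R]_m * 'rV[R]_d)) (f : 'rV[R]_m -> 'rV[R]_d -> R).
Hypotheses (Xc : cadlag X) (xic : cadlag xi) (oU : open U) (fC : C12 U f).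
Hypothesis A_FV : forall i, FV_loc (fun t => A t ord0 i).
Hypothesis xiE : {in `[0, T], forall t, xi t = grad_x f (A t) (X t)}.
Hypothesis rc : relatively_compact_in U [set (A t, X t) | t in `[0, T]].

Let F t := f (A t) (X t).

Lemma A_left tau : 0 < tau -> exists a0 : 'rV[R]_m,
  forall i, A v ord0 i @[v --> tau^'-] --> a0 ord0 i.
Proof.
move=> tau0.
have /choice[l lP] : forall i, exists l : R, A v ord0 i @[v --> tau^'-] --> l.
  by move=> i; exact: (A_FV i).1.2.
by exists (\row_i l i) => i; rewrite mxE.
Qed.

(** A compact set is closed, so the relative closure of the trajectory in U
    contains the limit points of the trajectory. *)
Lemma left_limit_in (a0 : 'rV[R]_m) (x0 : 'rV[R]_d) (tau : R) :
  0 < tau -> tau <= T ->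
  (forall i, A v ord0 i @[v --> tau^'-] --> a0 ord0 i) ->
  (forall j, X v ord0 j @[v --> tau^'-] --> x0 ord0 j) -> U (a0, x0).
Proof.
move=> tau0 tauT Aa Xx; have [SU cK] := rc.
set S := [set _ | _ in _] in SU cK.
have clS : closure S (a0, x0).
  move=> B /nbhs_box[r r0 rB].
  have : \forall v \near tau^'-, [/\ 0 <= v, v <= T,
      in_box a0 r (A v) & in_box x0 r (X v)].
    have Ar := near_in_box _ r0 Aa; have Xr := near_in_box _ r0 Xx.
    near=> v; split.
    - by apply/ltW; near: v; exact: nbhs_left_gt.
    - by apply: le_trans tauT; apply/ltW; near: v; exact: nbhs_left_lt.
    - by near: v; exact: Ar.
    - by near: v; exact: Xr.
  move=> /filter_ex[v [v0 vT Av Xv]]; exists (A v, X v); split.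
    by exists v => //=; rewrite in_itv/= v0.
  exact: rB.
have clK : closed (closure S `&` U).
  by apply: compact_closed => //; exact: norm_hausdorff.
have SK : S `<=` closure S `&` U.
  by move=> z Sz; split; [exact: subset_closure|exact: SU].
have := closure_subset SK clS.
by rewrite -(closure_id _).1// => -[].
Unshelve. all: by end_near.
Qed.

(** Partial derivatives that are continuous make f continuous; this is read off
    the expansion around (a0, x0) itself. *)
Lemma C12_cvg_left (a0 : 'rV[R]_m) (x0 : 'rV[R]_d) tau : U (a0, x0) ->
  (forall i, A v ord0 i @[v --> tau^'-] --> a0 ord0 i) ->
  (forall j, X v ord0 j @[v --> tau^'-] --> x0 ord0 j) ->
  F v @[v --> tau^'-] --> f a0 x0.
Proof.
move=> U0 Aa Xx.
have [c [Q /(_ 1 ltr01)[r r0 rP]]] := C12_expansion oU fC U0.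
have da i : A v ord0 i - a0 ord0 i @[v --> tau^'-] --> (0 : R).
  by rewrite -(subrr (a0 ord0 i)); apply: cvgB; [exact: Aa|exact: cvg_cst].
have dx j : X v ord0 j - x0 ord0 j @[v --> tau^'-] --> (0 : R).
  by rewrite -(subrr (x0 ord0 j)); apply: cvgB; [exact: Xx|exact: cvg_cst].
pose lin v := dot (grad_x f a0 x0) (X v - x0).
pose slope v := \sum_(i < m) c i * (A v ord0 i - a0 ord0 i).
pose quad v := \sum_(j < d) \sum_(k < d) Q j k *
  ((X v ord0 j - x0 ord0 j) * (X v ord0 k - x0 ord0 k)).
have lin0 : lin v @[v --> tau^'-] --> (0 : R).
  have -> : lin = fun v => \sum_(j < d) grad_x f a0 x0 ord0 j *
      (X v ord0 j - x0 ord0 j).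
    by apply/funext => v; apply: eq_bigr => j _; rewrite !mxE.
  apply: (@cvg_sumr0 _ _ _ _ _ (fun j v => grad_x f a0 x0 ord0 j *
      (X v ord0 j - x0 ord0 j))) => j.
  by rewrite -[0](mulr0 (grad_x f a0 x0 ord0 j)); exact: cvgMr.
have slope0 : slope v @[v --> tau^'-] --> (0 : R).
  apply: (@cvg_sumr0 _ _ _ _ _ (fun i v => c i *
      (A v ord0 i - a0 ord0 i))) => i.
  by rewrite -[0](mulr0 (c i)); exact: cvgMr.
have dxx j k : (X v ord0 j - x0 ord0 j) * (X v ord0 k - x0 ord0 k)
    @[v --> tau^'-] --> (0 : R) by rewrite -[0](mulr0 0); exact: cvgM.
have quad0 : quad v @[v --> tau^'-] --> (0 : R).
  apply: (@cvg_sumr0 _ _ _ _ _ (fun j v => \sum_(k < d) Q j k *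
    ((X v ord0 j - x0 ord0 j) * (X v ord0 k - x0 ord0 k)))) => j.
  apply: (@cvg_sumr0 _ _ _ _ _ (fun k v => Q j k *
    ((X v ord0 j - x0 ord0 j) * (X v ord0 k - x0 ord0 k)))) => k.
  by rewrite -[0](mulr0 (Q j k)); apply: cvgMr.
have bound0 : \sum_(i < m) `|A v ord0 i - a0 ord0 i| +
    \sum_(j < d) (X v ord0 j - x0 ord0 j) ^+ 2 @[v --> tau^'-] --> (0 : R).
  have H1 : \sum_(i < m) `|A v ord0 i - a0 ord0 i| @[v --> tau^'-] --> (0 : R).
    apply: (@cvg_sumr0 _ _ _ _ _ (fun i v => `|A v ord0 i - a0 ord0 i|)) => i.
    by rewrite -(normr0 R); exact: cvg_norm.
  have H2 : \sum_(j < d) (X v ord0 j - x0 ord0 j) ^+ 2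
      @[v --> tau^'-] --> (0 : R).
    apply: (@cvg_sumr0 _ _ _ _ _
      (fun j v => (X v ord0 j - x0 ord0 j) ^+ 2)) => j.
    by under eq_fun do rewrite expr2; exact: dxx.
  have H := cvgD H1 H2; rewrite addr0 in H; exact: H.
have rest0 : F v - f a0 x0 - lin v - slope v - quad v
    @[v --> tau^'-] --> (0 : R).
  apply: squeeze0 bound0.
  have Ar := near_in_box _ r0 Aa; have Xr := near_in_box _ r0 Xx.
  near=> v; rewrite -[leRHS]mul1r; apply: rP.
  - exact: in_box_center.
  - exact: in_box_center.
  - by near: v; exact: Ar.
  - by near: v; exact: Xr.
have c0 : cst (f a0 x0) v @[v --> tau^'-] --> f a0 x0 by exact: cvg_cst.
have H := cvgD (cvgD (cvgD (cvgD c0 lin0) slope0) quad0) rest0.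
rewrite !addr0 in H.
rewrite [X in X @ _](_ : _ = cst (f a0 x0) + lin + slope + quad +
  (fun v => F v - f a0 x0 - lin v - slope v - quad v)); first exact: H.
by apply/funext => v; rewrite !fctE /cst; ring.
Unshelve. all: by end_near.
Qed.

Lemma ito_model_cvg_left c Q (a0 : 'rV[R]_m) (x0 : 'rV[R]_d) tau :
  (forall i, A v ord0 i @[v --> tau^'-] --> a0 ord0 i) ->
  (forall j, X v ord0 j @[v --> tau^'-] --> x0 ord0 j) ->
  cvg (F v @[v --> tau^'-]) ->
  cvg (ito_model A X F c Q v tau @[v --> tau^'-]).
Proof.
move=> Aa Xx /cvg_ex[l Fl]; apply/cvg_ex.
exists (F tau - l - \sum_(i < m) c i * (A tau ord0 i - a0 ord0 i)
  - \sum_(j < d) \sum_(k < d) Q j k *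
      ((X tau ord0 j - x0 ord0 j) * (X tau ord0 k - x0 ord0 k))).
have dx j : X tau ord0 j - X v ord0 j @[v --> tau^'-] -->
    X tau ord0 j - x0 ord0 j by apply: cvgB; [exact: cvg_cst|exact: Xx].
apply: cvgB; first apply: cvgB.
- by apply: cvgB; [exact: cvg_cst|exact: Fl].
- apply: (@cvg_sumr _ _ _ _ _
    (fun i v => c i * (A tau ord0 i - A v ord0 i))) => i.
  by apply: cvgMr; apply: cvgB; [exact: cvg_cst|exact: Aa].
- apply: (@cvg_sumr _ _ _ _ _ (fun j v => \sum_(k < d) Q j k *
      ((X tau ord0 j - X v ord0 j) * (X tau ord0 k - X v ord0 k)))) => j.
  apply: (@cvg_sumr _ _ _ _ _ (fun k v => Q j k *
      ((X tau ord0 j - X v ord0 j) * (X tau ord0 k - X v ord0 k)))) => k.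
  by apply: cvgMr; apply: cvgM; exact: dx.
Qed.

Lemma local_expansion (a0 : 'rV[R]_m) (x0 : 'rV[R]_d) : U (a0, x0) ->
  exists c Q, forall e, 0 < e -> exists2 r : R, 0 < r &
    forall v w, 0 <= v -> v <= w -> w <= T ->
      in_box a0 r (A v) -> in_box x0 r (X v) ->
      in_box a0 r (A w) -> in_box x0 r (X w) ->
      `|increment xi X v w - ito_model A X F c Q v w| <= e * control A X v w.
Proof.
move=> U0; have [c [Q cQ]] := C12_expansion oU fC U0.
exists c, Q => e e0; have [r r0 rP] := cQ e e0.
exists r => // v w v0 vw wT Av Xv Aw Xw.
apply: le_trans (ler_wpM2l (ltW e0) (le_control _ A_FV v0 vw)).
apply: le_trans (rP _ _ _ _ Av Xv Aw Xw).
rewrite /increment xiE; last by rewrite in_itv/= v0 (le_trans vw).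
rewrite -normrN /ito_model le_eqVlt; apply/orP; left; apply/eqP.
by congr `|_|; rewrite /F; ring.
Qed.

Lemma admissible_ito_expansion : ito_expansion A X xi F T.
Proof.
move=> tau tau0 tauT; split.
  have U0 : U (A tau, X tau).
    by apply: rc.1; exists tau => //=; rewrite in_itv/= tau0.
  have [c [Q cQ]] := local_expansion U0; exists c, Q => e e0.
  have [r r0 rP] := cQ e e0.
  have Ar : \forall v \near tau^'+, in_box (A tau) r (A v).
    by apply: near_in_box => // i; exact: (A_FV i).1.1.
  have Xr : \forall v \near tau^'+, in_box (X tau) r (X v).
    by apply: near_in_box => // j; exact: coord_right.
  have [delta d0 dP] := at_right_ex (filterI Ar Xr).
  have box v : tau <= v -> v < tau + delta ->
      in_box (A tau) r (A v) /\ in_box (X tau) r (X v).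
    rewrite le_eqVlt => /predU1P[<- _|tv vd]; last exact: dP.
    by split; exact: in_box_center.
  exists delta => // v w tv vw wd wT.
  have [Av Xv] := box v tv (le_lt_trans vw wd).
  have [Aw Xw] := box w (le_trans tv vw) wd.
  by apply: rP => //; exact: le_trans tau0 tv.
move=> {}tau0; have [a0 Aa] := A_left tau0; have [x0 Xx] := coord_left Xc tau0.
have U0 := left_limit_in tau0 tauT Aa Xx.
have [c [Q cQ]] := local_expansion U0; exists c, Q; split.
  apply: is_cvgB; first exact: increment_cvg_left.
  apply: (@ito_model_cvg_left c Q a0 x0) => //; apply/cvg_ex.
  by exists (f a0 x0); exact: (C12_cvg_left U0 Aa Xx).
move=> e e0; have [r r0 rP] := cQ e e0.
have [delta d0 dP] := at_left_ex (filterI (near_in_box _ r0 Aa)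
  (near_in_box _ r0 Xx)).
exists delta => // v w tv v0 vw wt.
have [Av Xv] := dP v tv (le_lt_trans vw wt).
have [Aw Xw] := dP w (lt_le_trans tv vw) wt.
by apply: rP => //; exact: le_trans (ltW wt) tauT.
Qed.

End admissible_expansion.

(** * Existence of the integral and its one-step residual *)

Lemma close_to_lim (R : realType) (x : nat -> R) (l l' c : R) :
  x @ \oo --> l' -> close_to x l c -> `|l' - l| <= c.
Proof.
move=> xl xc; apply/ler_addgt0Pr => e e0.
have e20 : 0 < e / 2 by rewrite divr_gt0.
move/cvgrPdist_le : xl => /(_ _ e20) xl.
have /filter_ex[n [A B]] : \forall n \near \oo,
    `|l' - x n| <= e / 2 /\ `|x n - l| <= c + e / 2.
  by apply: filterI => //; exact: xc.
have -> : l' - l = (l' - x n) + (x n - l) by ring.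
by apply: le_trans (ler_normD _ _) _; lra.
Qed.

Lemma cvg_near_bounded (R : realType) (S : Type) (F : set_system S)
    (FF : Filter F) (f : S -> R) : cvg (f @ F) ->
  exists M : R, \forall x \near F, `|f x| <= M.
Proof.
move=> /cvg_ex[l /cvgrPdist_le/(_ 1 ltr01) fl]; exists (`|l| + 1).
apply: filterS fl => x lx; rewrite -[f x](subKr l).
by apply: le_trans (ler_normB _ _) _; rewrite lerD2l.
Qed.

Section ito_follmer.
Variables (R : realType) (Pi : nat -> nat -> R) (N : nat -> nat) (T : R).
Hypotheses (Pi0 : forall n, Pi n 0%N = 0)
  (Pi_lt : forall n i, Pi n i < Pi n i.+1)
  (PiN : forall n, T <= Pi n (N n))
  (Pi_fine : forall delta, 0 < delta ->
     \forall n \near \oo, forall i, Pi n i.+1 - Pi n i < delta).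
Variables (m d : nat) (A : R -> 'rV[R]_m) (X xi : R -> 'rV[R]_d) (F : R -> R).
Hypotheses (X_QV : QV Pi X) (xic : cadlag xi).
Hypothesis A_FV : forall i, FV_loc (fun t => A t ord0 i).
Hypothesis expansion : ito_expansion A X xi F T.

Let Xc : cadlag X := X_QV.1.

Lemma control_limit : exists beta : R -> R,
  [/\ forall s u, 0 <= s -> s <= u -> u <= T ->
        psums Pi N (control A X) s u @ \oo --> beta u - beta s,
      forall s, 0 <= s -> beta u @[u --> s^'+] --> beta s &
      forall s u, 0 <= s -> s <= u -> beta s <= beta u].
Proof.
have [q [qP qr qm]] := QV_square Pi0 Pi_lt PiN Pi_fine X_QV.
pose V i := variation_upto (fun t => A t ord0 i).
exists (fun u => \sum_i V i u + \sum_j q j u); split.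
- move=> s u s0 su uT.
  have -> : \sum_i V i u + \sum_j q j u - (\sum_i V i s + \sum_j q j s) =
      \sum_i (V i u - V i s) - \sum_j - (1) * (q j u - q j s).
    by rewrite -mulr_sumr mulN1r opprK !sumrB; ring.
  rewrite [X in X @ _](_ : _ = psums Pi N (fun v w =>
      \sum_i (V i w - V i v) -
      \sum_j (- (1)) * (X w ord0 j - X v ord0 j) ^+ 2) s u); last first.
    apply/funext => n; apply: eq_bigr => i _.
    by rewrite /control -mulr_sumr mulN1r opprK.
  apply: psums_cvgB.
    apply: (@psums_cvg_sum _ _ _ _ (fun i v w => V i w - V i v)) => i.
    exact: (psums_telescope (T := T)).
  apply: (@psums_cvg_sum _ _ _ _ (fun j v w =>
    - (1) * (X w ord0 j - X v ord0 j) ^+ 2)) => j.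
  by apply: psums_cvgZ; exact: qP.
- move=> s s0; apply: cvgD.
    by apply: cvg_sumr => i; exact: variation_right_continuous.
  by apply: cvg_sumr => j; exact: qr.
- move=> s u s0 su; apply: lerD; apply: ler_sum => i _; last exact: qm.
  rewrite -subr_ge0; apply: le_trans (normr_ge0 _) _; last first.
  exact: (@variation_increment _ (fun t => A t ord0 i)).
Qed.

Lemma psums_ito_model c Q s u : 0 <= s -> s <= u -> u <= T -> exists l : R,
  psums Pi N (ito_model A X F c Q) s u @ \oo --> l.
Proof.
move=> s0 su uT.
have /choice[L LP] : forall jk : 'I_d * 'I_d, exists l : R,
    psums Pi N (fun x y => (X y ord0 jk.1 - X x ord0 jk.1) *
                        (X y ord0 jk.2 - X x ord0 jk.2)) s u @ \oo --> l.
  by move=> jk; exact: (QV_product Pi0 Pi_lt PiN Pi_fine X_QV).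
eexists; apply: psums_cvgB; first apply: psums_cvgB.
- exact: (psums_telescope (T := T)).
- apply: (@psums_cvg_sum _ _ _ _ (fun i v w =>
    c i * (A w ord0 i - A v ord0 i))) => i.
  apply: psums_cvgZ.
  exact: (@psums_telescope _ _ _ T Pi0 PiN (fun t => A t ord0 i)).
- apply: (@psums_cvg_sum _ _ _ _ (fun j v w => \sum_(k < d) Q j k *
      ((X w ord0 j - X v ord0 j) * (X w ord0 k - X v ord0 k)))) => j.
  apply: (@psums_cvg_sum _ _ _ _ (fun k v w => Q j k *
      ((X w ord0 j - X v ord0 j) * (X w ord0 k - X v ord0 k)))) => k.
  by apply: psums_cvgZ; exact: (LP (j, k)).
Qed.

Lemma nearly_additive_increment : nearly_additive T (increment xi X).
Proof.
rewrite (_ : increment xi X = fun v w =>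
  \sum_(j < d) xi v ord0 j * (X w ord0 j - X v ord0 j)); last first.
  by apply/funext => v; apply/funext => w; exact: incrementE.
apply: (@nearly_additive_sum _ _ _ (fun j v w =>
  xi v ord0 j * (X w ord0 j - X v ord0 j))) => j.
apply: (@nearly_additive_mulr _ _ (fun v => xi v ord0 j)
  (fun v w => X w ord0 j - X v ord0 j)).
- exact: (nearly_additive_diff T (fun t => X t ord0 j)).
- move=> s s0 _; have [l lP] := coord_left xic s0.
  by apply/cvg_ex; exists (l ord0 j).
- move=> s s0 _; rewrite -(subrr (X s ord0 j)).
  by apply: cvgB; [exact/coord_right/ltW|exact: cvg_cst].
Qed.

Lemma ito_model_xx c Q v : ito_model A X F c Q v v = 0.
Proof.
rewrite /ito_model subrr !big1 ?subr0// => [j _|i _].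
  by rewrite big1// => k _; rewrite subrr !mul0r mulr0.
by rewrite subrr mulr0.
Qed.

Lemma increment_xx v : increment xi X v v = 0.
Proof. exact: nearly_additive_increment.1. Qed.

(** Near each tau the sums of the increments are compared with those of the
    model, which converge by [psums_ito_model]; [sewing] then gives a Cauchy
    sequence. *)
Lemma ito_follmer_exists u : 0 <= u -> u <= T ->
  cvgn (psums Pi N (increment xi X) 0 u).
Proof.
move=> u0 uT; have [beta [betaP _ _]] := control_limit.
apply: (@close_to_is_cvg _ _ (beta u - beta 0)) => e e0.
suff [l _ ?] : exists2 l, setT l & close_to (psums Pi N (increment xi X) 0 u) l
    (e * (beta u - beta 0)) by exists l.
apply: (sewing Pi_lt Pi_fine (T := T)) => //.
  exact: nearly_additive_increment.
move=> {e e0}e tau e0 tau0 tauT; have [[c [Q cQ]] left] := expansion tau0 tauT.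
have [dr dr0 drP] := cQ e e0.
have [dl dl0 dlP] : exists2 dl, 0 < dl & forall s, 0 <= s -> s < tau ->
    tau - dl < s -> exists2 l, setT l &
    close_to (psums Pi N (increment xi X) s tau) l (e * (beta tau - beta s)).
  move: tau0; rewrite le_eqVlt => /predU1P[<-|tau0].
    by exists 1 => // s s0 s0'; have := le_lt_trans s0 s0'; rewrite ltxx.
  have [c' [Q' [/cvg_ex[l ll] /(_ e e0)[dl dl0 dlP]]]] := left tau0.
  exists dl => // s s0 stau taus.
  have [l' l'P] := psums_ito_model c' Q' s0 (ltW stau) tauT.
  exists (l' + l) => //.
  apply: (psums_close_left Pi0 Pi_lt PiN Pi_fine
    (h := ito_model A X F c' Q') (b := control A X)) => //.
  - exact: ltW.
  - exact: increment_xx.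
  - exact: ito_model_xx.
  - by move=> x y sx xy _; apply: control_ge0 => //; exact: le_trans sx.
  - move=> x y sx xy ytau; apply: dlP => //; first exact: lt_le_trans sx.
    exact: le_trans sx.
  - by apply: betaP => //; exact: ltW.
exists (Num.min dr dl); first by rewrite lt_min dr0.
have dd : Num.min dr dl <= dr by rewrite ge_min lexx.
have dd' : Num.min dr dl <= dl by rewrite ge_min lexx orbT.
move=> s v [->|->] s0 sv vT taus vtau; last by apply: dlP => //; lra.
have [l lP] := psums_ito_model c Q s0 (ltW sv) vT.
exists l => //; apply: (psums_close Pi_lt (h := ito_model A X F c Q)
  (b := control A X)) => //.
- exact: ltW.
- move=> x y taux xy yv; apply: drP => //; last exact: le_trans vT.
  by apply: (le_lt_trans yv); lra.
- by apply: betaP => //; exact: ltW.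
Qed.

Section integral.
Variable Y : R -> R.
Hypothesis Y_lim : forall u, 0 <= u -> u <= T ->
  psums Pi N (increment xi X) 0 u @ \oo --> Y u.
Variable beta : R -> R.
Hypothesis beta_lim : forall s u, 0 <= s -> s <= u -> u <= T ->
  psums Pi N (control A X) s u @ \oo --> beta u - beta s.
Hypothesis beta_right : forall s, 0 <= s -> beta u @[u --> s^'+] --> beta s.
Hypothesis beta_le : forall s u, 0 <= s -> s <= u -> beta s <= beta u.

Definition residual v w : R := Y w - Y v - increment xi X v w.

(** Besides the control, the bound on the residual involves the limit beta of
    its sums, because the residual contains an increment of the limit Y. *)
Definition full_control v w : R := control A X v w + (beta w - beta v).

Lemma residual_cvg0 s u : 0 <= s -> s <= u -> u <= T ->
  psums Pi N residual s u @ \oo --> (0 : R).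
Proof.
move=> s0 su uT; rewrite -(subrr (Y u - Y s)); apply: psums_cvgB.
  exact: (psums_telescope (T := T)).
apply: (psums_cvg_sub Pi_lt Pi_fine nearly_additive_increment) => //.
  by apply: Y_lim => //; exact: le_trans uT.
by apply: Y_lim => //; exact: le_trans su.
Qed.

Lemma full_control_lim s u : 0 <= s -> s <= u -> u <= T ->
  psums Pi N full_control s u @ \oo -->
    (2 * beta u - 2 * beta s).
Proof.
move=> s0 su uT.
have -> : 2 * beta u - 2 * beta s =
  (beta u - beta s) - - (1) * (beta u - beta s) by ring.
rewrite (_ : full_control = fun v w =>
    control A X v w - - (1) * (beta w - beta v)); last first.
  by apply/funext => v; apply/funext => w; rewrite /full_control; ring.
apply: psums_cvgB; first exact: beta_lim.
by apply: psums_cvgZ; exact: (psums_telescope (T := T)).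
Qed.

Lemma full_control_ge0 v w : 0 <= v -> v <= w -> 0 <= full_control v w.
Proof.
by move=> v0 vw; rewrite addr_ge0 ?control_ge0// subr_ge0 beta_le.
Qed.

(** The sums of dF - inc over [s, u] tend to dF - dY, and they are dominated by
    those of C times the control; so dF - dY is at most C (beta u - beta s). The
    hypothesis on [s, u] itself then bounds dY - inc. *)
Lemma residual_bound s u C : 0 <= s -> s <= u -> u <= T -> 0 <= C ->
  (forall v w, s <= v -> v <= w -> w <= u ->
     `|F w - F v - increment xi X v w| <= C * control A X v w) ->
  `|residual s u| <= C * full_control s u.
Proof.
move=> s0 su uT C0 FC.
have G : psums Pi N (fun v w => F w - F v - increment xi X v w) s u @ \oo -->
    (F u - F s) - (Y u - Y s).
  apply: psums_cvgB; first exact: (psums_telescope (T := T)).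
  apply: (psums_cvg_sub Pi_lt Pi_fine nearly_additive_increment) => //.
    by apply: Y_lim => //; exact: le_trans uT.
  by apply: Y_lim => //; exact: le_trans su.
(* a bound by the control is a comparison with the zero interval function *)
have Z : psums Pi N (fun=> fun=> 0 : R) s u @ \oo --> (0 : R).
  rewrite [X in X @ _](_ : _ = fun=> 0); first exact: cvg_cst.
  by apply/funext => n; apply: big1.
have := close_to_lim G (psums_close Pi_lt su _ Z (beta_lim s0 su uT)).
move=> /(_ C); rewrite subr0 => H.
have {}H : `|F u - F s - (Y u - Y s)| <= C * (beta u - beta s).
  by apply: H => v w sv vw wu; rewrite subr0; exact: FC.
have := FC s u (lexx s) su (lexx u).
have -> : C * full_control s u =
  C * control A X s u + C * (beta u - beta s) by exact: mulrDr.
rewrite /residual; move: H; rewrite !ler_norml => /andP[? ?] /andP[? ?].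
by apply/andP; split; lra.
Qed.

Lemma residual_right tau : 0 <= tau -> tau <= T -> exists2 C, 0 <= C &
  exists2 delta, 0 < delta & forall v w, tau <= v -> v <= w ->
    w < tau + delta -> w <= T -> `|residual v w| <= C * full_control v w.
Proof.
move=> tau0 tauT; have [[c [Q /(_ 1 ltr01)[delta d0 dP]]] _] :=
  expansion tau0 tauT.
have [C C0 CP] := ito_model_bound X A_FV F c Q.
exists (C + 1); first exact: addr_ge0.
exists delta => // v w tv vw wd wT.
apply: residual_bound => //; [exact: le_trans tv|exact: addr_ge0|].
move=> x y vx xy yw; have tx := le_trans tv vx.
have := CP x y (le_trans tau0 tx) xy.
have := dP x y tx xy (le_lt_trans yw wd) (le_trans yw wT).
rewrite mulrDl mul1r !ler_norml => /andP[? ?] /andP[? ?].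
by apply/andP; split; lra.
Qed.

Lemma residual_left tau : 0 < tau -> tau <= T -> exists2 C, 0 <= C &
  exists2 delta, 0 < delta & forall v w, tau - delta < v -> 0 <= v ->
    v <= w -> w < tau -> `|residual v w| <= C * full_control v w.
Proof.
move=> tau0 tauT; have [_ /(_ tau0)[c [Q [_ /(_ 1 ltr01)[delta d0 dP]]]]] :=
  expansion (ltW tau0) tauT.
have [C C0 CP] := ito_model_bound X A_FV F c Q.
exists (C + 1); first exact: addr_ge0.
exists delta => // v w tv v0 vw wtau.
apply: residual_bound => //; [exact: le_trans (ltW wtau) tauT|exact: addr_ge0|].
move=> x y vx xy yw.
have := CP x y (le_trans v0 vx) xy.
have := dP x y (lt_le_trans tv vx) (le_trans v0 vx) xy (le_lt_trans yw wtau).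
rewrite mulrDl mul1r !ler_norml => /andP[? ?] /andP[? ?].
by apply/andP; split; lra.
Qed.

Lemma full_control_right s : 0 <= s ->
  full_control s y @[y --> s^'+] --> (0 : R).
Proof.
move=> s0.
have H1 : \sum_(i < m) (variation_upto (fun t => A t ord0 i) y -
    variation_upto (fun t => A t ord0 i) s) @[y --> s^'+] --> (0 : R).
  apply: (@cvg_sumr0 _ _ _ _ _ (fun i y =>
    variation_upto (fun t => A t ord0 i) y -
    variation_upto (fun t => A t ord0 i) s)) => i.
  rewrite -(subrr (variation_upto (fun t => A t ord0 i) s)).
  by apply: cvgB; [exact: variation_right_continuous|exact: cvg_cst].
have dx j : X y ord0 j - X s ord0 j @[y --> s^'+] --> (0 : R).
  by rewrite -(subrr (X s ord0 j)); apply: cvgB;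
    [exact: coord_right|exact: cvg_cst].
have H2 : \sum_(j < d) (X y ord0 j - X s ord0 j) ^+ 2
    @[y --> s^'+] --> (0 : R).
  apply: (@cvg_sumr0 _ _ _ _ _
    (fun j y => (X y ord0 j - X s ord0 j) ^+ 2)) => j.
  under eq_fun do rewrite expr2.
  by have H := cvgM (dx j) (dx j); rewrite mul0r in H; exact: H.
have H3 : beta y - beta s @[y --> s^'+] --> (0 : R).
  by rewrite -(subrr (beta s)); apply: cvgB; [exact: beta_right|exact: cvg_cst].
by have H := cvgD (cvgD H1 H2) H3; rewrite !addr0 in H; exact: H.
Qed.

(** The bound of [residual_right] tends to 0, since A, X and beta are right
    continuous. This is what makes the weighted residual nearly additive. *)
Lemma residual_right0 tau : 0 <= tau -> tau < T ->
  residual tau y @[y --> tau^'+] --> (0 : R).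
Proof.
move=> tau0 tauT; have [C C0 [delta d0 dP]] := residual_right tau0 (ltW tauT).
have H : C * full_control tau y @[y --> tau^'+] --> (0 : R).
  by rewrite -(mulr0 C); apply: cvgMr; exact: full_control_right.
apply: squeeze0 H; near=> y; apply: dP => //.
- by near: y; apply: nbhs_right_lt; rewrite ltrDl.
- by apply/ltW; near: y; exact: nbhs_right_lt.
Unshelve. all: by end_near.
Qed.

(** The estimate of [residual_left] does not reach tau. Splitting at a fixed
    time v0 just before tau reduces to the residual on [v0, v] and to increments
    of X against fixed or convergent values of xi. *)
Lemma residual_left_bounded tau : 0 < tau -> tau <= T ->
  exists M : R, \forall v \near tau^'-, `|residual v tau| <= M.
Proof.
move=> tau0 tauT; have [C C0 [delta d0 dP]] := residual_left tau0 tauT.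
have [x0 Xx] := coord_left Xc tau0.
have [v0 [v00 v0tau tauv0]] : exists v0,
    [/\ 0 <= v0, v0 < tau & tau - delta < v0].
  exists (Num.max 0 (tau - delta / 2)); split.
  - by rewrite le_max lexx.
  - by rewrite gt_max tau0/= ltrBlDr ltrDl divr_gt0.
  - by rewrite lt_max; apply/orP; right; lra.
have [M1 M1P] : exists M : R, \forall v \near tau^'-,
    `|increment xi X v tau| <= M.
  by apply: cvg_near_bounded; exact: increment_cvg_left.
have [M2 M2P] : exists M : R, \forall v \near tau^'-,
    `|increment xi X v0 v| <= M.
  apply: cvg_near_bounded.
  rewrite (_ : increment xi X v0 = fun v =>
    \sum_(j < d) xi v0 ord0 j * (X v ord0 j - X v0 ord0 j)); last first.
    by apply/funext => v; exact: incrementE.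
  apply/cvg_ex; exists (\sum_j xi v0 ord0 j * (x0 ord0 j - X v0 ord0 j)).
  apply: (@cvg_sumr _ _ _ _ _
    (fun j v => xi v0 ord0 j * (X v ord0 j - X v0 ord0 j))) => j.
  by apply: cvgMr; apply: cvgB; [exact: Xx|exact: cvg_cst].
have [M3 M3P] : exists M : R, \forall v \near tau^'-,
    `|\sum_(j < d) (X v ord0 j - X v0 ord0 j) ^+ 2| <= M.
  apply: cvg_near_bounded.
  apply/cvg_ex; exists (\sum_(j < d) (x0 ord0 j - X v0 ord0 j) ^+ 2).
  apply: (@cvg_sumr _ _ _ _ _
    (fun j v => (X v ord0 j - X v0 ord0 j) ^+ 2)) => j.
  under eq_fun do rewrite expr2; rewrite expr2.
  by apply: cvgM; apply: cvgB;
    [exact: Xx|exact: cvg_cst|exact: Xx|exact: cvg_cst].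
pose V i := variation_upto (fun t => A t ord0 i).
pose M4 := \sum_(i < m) (V i tau - V i v0) + M3 + (beta tau - beta v0).
exists (`|Y tau - Y v0| + M1 + M2 + C * M4).
near=> v.
have v0v : v0 <= v by apply/ltW; near: v; exact: nbhs_left_gt.
have vtau : v < tau by near: v; exact: nbhs_left_lt.
have vge0 := le_trans v00 v0v.
have A1 : `|increment xi X v tau| <= M1 by near: v; exact: M1P.
have A2 : `|increment xi X v0 v| <= M2 by near: v; exact: M2P.
have A3 : `|\sum_(j < d) (X v ord0 j - X v0 ord0 j) ^+ 2| <= M3.
  by near: v; exact: M3P.
have A4 : full_control v0 v <= M4.
  rewrite /full_control /control /M4; apply: lerD; last first.
    by rewrite lerD2r beta_le// ltW.
  apply: lerD; last exact: le_trans (ler_norm _) A3.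
  apply: ler_sum => i _; rewrite lerD2r -subr_ge0.
  apply: le_trans (normr_ge0 _) _; last first.
  apply: (@variation_increment _ (fun t => A t ord0 i)) => //; exact: ltW.
have A5 : `|residual v0 v| <= C * M4.
  exact: le_trans (dP v0 v tauv0 v00 v0v vtau) (ler_wpM2l C0 A4).
have -> : residual v tau = (Y tau - Y v0) - increment xi X v tau
    - increment xi X v0 v - residual v0 v by rewrite /residual; ring.
by apply: le_trans (ler_normB _ _) _; apply: lerD => //;
  apply: le_trans (ler_normB _ _) _; apply: lerD => //;
  apply: le_trans (ler_normB _ _) _; apply: lerD.
Unshelve. all: by end_near.
Qed.

(** Freeze eta at tau on the right and at its left limit on the left. On
    intervals ending at tau the replacement error tends to 0 by itself, since
    the residual is bounded there. *)
Lemma weighted_residual_cvg0 (eta : R -> R) u :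
  (forall s, 0 <= s -> eta v @[v --> s^'+] --> eta s) ->
  (forall s, 0 < s -> exists l : R, eta v @[v --> s^'-] --> l) ->
  0 <= u -> u <= T ->
  psums Pi N (fun v w => eta v * residual v w) 0 u @ \oo --> (0 : R).
Proof.
move=> eta_right eta_left u0 uT.
pose g v w := eta v * residual v w.
have gna : nearly_additive T g.
  apply: nearly_additive_mulr.
  - apply: nearly_additiveB; first exact: nearly_additive_diff.
    exact: nearly_additive_increment.
  - by move=> s s0 _; apply/cvg_ex; exact: eta_left.
  - by move=> s s0 sT; apply: residual_right0 => //; exact: ltW.
have gxx x : g x x = 0 by exact: gna.1.
apply: (@close_to_cvg0 _ _ (2 * beta u - 2 * beta 0)) => e e0.
suff [l -> //] : exists2 l, [set 0] l &
    close_to (psums Pi N g 0 u) l (e * (2 * beta u - 2 * beta 0)).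
apply: (sewing Pi_lt Pi_fine (T := T) (beta := fun u => 2 * beta u)) => //.
  by move=> l l' -> ->; rewrite /= addr0.
move=> {e e0}e tau e0 tau0 tauT.
have cst_res c s v : 0 <= s -> s <= v -> v <= T ->
    psums Pi N (fun x y => c * residual x y) s v @ \oo --> (0 : R).
  move=> s0 sv vT; rewrite -(mulr0 c).
  by apply: psums_cvgZ; exact: residual_cvg0.
have gle c C x y : 0 <= C -> 0 <= x -> x <= y ->
    `|residual x y| <= C * full_control x y -> `|eta x - c| <= e / (C + 1) ->
    `|g x y - c * residual x y| <= e * full_control x y.
  move=> C0 x0 xy rC ec; rewrite /g -mulrBl normrM.
  apply: le_trans (ler_pM _ _ ec rC) _ => //.
  rewrite mulrA ler_wpM2r ?full_control_ge0// mulrAC ler_pdivrMr ?ltr_wpDl//.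
  by rewrite ler_pM2l// lerDl.
have [dr dr0 drP] : exists2 dr, 0 < dr & forall v, tau < v -> v <= T ->
    v < tau + dr -> close_to (psums Pi N g tau v) 0
      (e * (2 * beta v - 2 * beta tau)).
  have [C C0 [d1 d10 d1P]] := residual_right tau0 tauT.
  have C1 : 0 < C + 1 by rewrite ltr_wpDl.
  have /cvgrPdist_le/(_ _ (divr_gt0 e0 C1))/at_right_ex[d2 d20 d2P] :=
    eta_right tau tau0.
  exists (Num.min d1 d2) => [|v tauv vT vd]; first by rewrite lt_min d10.
  have dd1 : Num.min d1 d2 <= d1 by rewrite ge_min lexx.
  have dd2 : Num.min d1 d2 <= d2 by rewrite ge_min lexx orbT.
  apply: (psums_close Pi_lt (h := fun x y => eta tau * residual x y)
    (b := full_control)).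
  - exact: ltW.
  - move=> x y taux xy yv; apply: (gle _ C) => //.
    + exact: le_trans taux.
    + apply: d1P => //; last exact: le_trans vT.
      by apply: le_lt_trans yv _; lra.
    + rewrite distrC; move: taux; rewrite le_eqVlt => /predU1P[<-|taux].
        by rewrite subrr normr0 divr_ge0// ltW.
      by apply: d2P => //; apply: le_lt_trans (le_trans xy yv) _; lra.
  - by apply: cst_res => //; exact: ltW.
  - by apply: full_control_lim => //; exact: ltW.
have [dl dl0 dlP] : exists2 dl, 0 < dl & forall s, 0 <= s -> s < tau ->
    tau - dl < s -> close_to (psums Pi N g s tau) 0
      (e * (2 * beta tau - 2 * beta s)).
  move: tau0; rewrite le_eqVlt => /predU1P[<-|{}tau0].
    by exists 1 => // s s0 s0'; have := le_lt_trans s0 s0'; rewrite ltxx.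
  have [C C0 [d1 d10 d1P]] := residual_left tau0 tauT.
  have C1 : 0 < C + 1 by rewrite ltr_wpDl.
  have [l etal] := eta_left tau tau0.
  have /cvgrPdist_le/(_ _ (divr_gt0 e0 C1))/at_left_ex[d2 d20 d2P] := etal.
  exists (Num.min d1 d2) => [|s s0 stau sd]; first by rewrite lt_min d10.
  have dd1 : Num.min d1 d2 <= d1 by rewrite ge_min lexx.
  have dd2 : Num.min d1 d2 <= d2 by rewrite ge_min lexx orbT.
  rewrite -[0](addr0 0).
  apply: (psums_close_left Pi0 Pi_lt PiN Pi_fine
    (h := fun x y => l * residual x y) (b := full_control)) => //.
  - exact: ltW.
  - by rewrite /residual increment_xx !subrr mulr0.
  - by move=> x y sx xy _; apply: full_control_ge0 => //; exact: le_trans sx.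
  - move=> x y sx xy ytau; apply: (gle _ C) => //.
    + exact: le_trans sx.
    + by apply: d1P => //; [lra|exact: le_trans sx].
    + by rewrite distrC; apply: d2P; [lra|exact: le_lt_trans ytau].
  - have [M MP] := residual_left_bounded tau0 tauT.
    have H : `|eta v - l| * M @[v --> tau^'-] --> (0 : R).
      rewrite -(mul0r M) -(normr0 R) -(subrr l); apply: cvgMl.
      by apply: cvg_norm; apply: cvgB => //; exact: cvg_cst.
    apply: squeeze0 H; apply: filterS MP => v vM.
    by rewrite /g -mulrBl normrM ler_wpM2l.
  - by apply: cst_res => //; exact: ltW.
  - by apply: full_control_lim => //; exact: ltW.
exists (Num.min dr dl); first by rewrite lt_min dr0.
have dd : Num.min dr dl <= dr by rewrite ge_min lexx.
have dd' : Num.min dr dl <= dl by rewrite ge_min lexx orbT.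
move=> s v [->|->] s0 sv vT taus vtau; exists 0 => //.
  by apply: drP => //; lra.
by apply: dlP => //; lra.
Qed.

End integral.
End ito_follmer.

(** * Associativity of the integral *)

Section partition_sequence.
Variables (R : realType) (Pi : nat -> nat -> R).
Hypothesis Pi_partition : forall n, is_partition (Pi n).

Lemma partition_reaches (T : R) : exists N : nat -> nat,
  forall n, T <= Pi n (N n).
Proof.
have /choice[N NP] : forall n, exists M, T <= Pi n M; last by exists N.
move=> n; have [_ _ /cvgryPge/(_ T)] := Pi_partition n.
by move=> /filter_ex[M TM]; exists M.
Qed.

Lemma mesh_fine (delta : R) : mesh (Pi n) @[n --> \oo] --> 0%E -> 0 < delta ->
  \forall n \near \oo, forall i, Pi n i.+1 - Pi n i < delta.
Proof.
move=> Pi_mesh d0.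
have : \forall n \near \oo, (mesh (Pi n) < delta%:E)%E.
  apply: (Pi_mesh [set x | (x < delta%:E)%E]).
  by apply: open_ereal_lt'; rewrite lte_fin.
apply: filterS => n nd i; rewrite -lte_fin; apply: le_lt_trans nd.
apply: le_trans (_ : `|Pi n i.+1 - Pi n i|%:E <= _)%E.
  by rewrite lee_fin ler_norm.
by apply: ereal_sup_ubound; exists i.
Qed.

End partition_sequence.

Section one_integrand.
Variables (R : realType) (Pi : nat -> nat -> R) (N : nat -> nat) (T : R).
Hypotheses (Pi0 : forall n, Pi n 0%N = 0)
  (Pi_lt : forall n i, Pi n i < Pi n i.+1)
  (PiN : forall n, T <= Pi n (N n))
  (Pi_fine : forall delta, 0 < delta ->
     \forall n \near \oo, forall i, Pi n i.+1 - Pi n i < delta).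
Variables (d : nat) (X xi : R -> 'rV[R]_d).
Hypotheses (T0 : 0 < T) (X_QV : QV Pi X) (xi_adm : admissible X xi).

Lemma weighted_admissible_residual_cvg0 (eta : R -> R) u :
  (forall s, 0 <= s -> eta v @[v --> s^'+] --> eta s) ->
  (forall s, 0 < s -> exists l : R, eta v @[v --> s^'-] --> l) ->
  0 <= u -> u <= T ->
  psums Pi N (fun v w => eta v *
    residual X xi (ito_follmer_integral Pi xi X) v w) 0 u @ \oo --> (0 : R).
Proof.
move=> eta_right eta_left u0 uT; have [xic /(_ T T0)] := xi_adm.
move=> [m [U [f [A [oU fC A_FV xiE rc]]]]].
have expansion := admissible_ito_expansion X_QV.1 xic oU fC A_FV xiE rc.
have [beta [beta_lim beta_right beta_le]] :=
  control_limit Pi0 Pi_lt PiN Pi_fine X_QV A_FV.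
apply: (weighted_residual_cvg0 Pi0 Pi_lt PiN Pi_fine X_QV xic A_FV expansion
  _ beta_lim beta_right beta_le eta_right eta_left u0 uT).
move=> v v0 vT.
have := ito_follmer_exists Pi0 Pi_lt PiN Pi_fine X_QV xic A_FV expansion v0 vT.
rewrite /ito_follmer_integral.
have -> : (fun n => riemann_sum (Pi n) xi X v) =
  psums Pi N (increment xi X) 0 v; last by [].
by apply/funext => n; exact: (riemann_sum_psums Pi0 Pi_lt PiN).
Qed.

End one_integrand.

Theorem theorem2p23 (R : realType) (Pi : nat -> nat -> R)
  (Pi_partition : forall n, is_partition (Pi n))
  (Pi_mesh : mesh (Pi n) @[n --> \oo] --> 0%E)
  (d nu : nat) (X : R -> 'rV[R]_d) (X_QV : QV Pi X)
  (xi : 'I_nu -> R -> 'rV[R]_d) (xi_adm : forall k, admissible X (xi k))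
  (eta : R -> 'rV[R]_nu) (eta_cadlag : cadlag eta)
  (t : R) (t_ge0 : 0 <= t) :
  let Y : R -> 'rV[R]_nu := fun s => \row_k ito_follmer_integral Pi (xi k) X s in
  let zeta : R -> 'rV[R]_d := fun s => \sum_(k < nu) eta s ord0 k *: xi k s in
  (ito_follmer_integrable Pi eta Y t <-> ito_follmer_integrable Pi zeta X t) /\
  (ito_follmer_integrable Pi eta Y t \/ ito_follmer_integrable Pi zeta X t ->
     ito_follmer_integral Pi eta Y t = ito_follmer_integral Pi zeta X t).
Proof.
(* admissibility speaks of positive horizons, and t may be 0 *)
move=> Y zeta; pose T := t + 1.
have tT : t <= T by rewrite lerDl.
have T0 : 0 < T by rewrite ltr_wpDl.
have [N PiN] := partition_reaches Pi_partition T.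
have Pi0 n : Pi n 0%N = 0 by case: (Pi_partition n).
have Pi_lt n i : Pi n i < Pi n i.+1 by case: (Pi_partition n).
have Pi_fine delta := @mesh_fine R Pi delta Pi_mesh.
have diff0 : riemann_sum (Pi n) eta Y t - riemann_sum (Pi n) zeta X t
    @[n --> \oo] --> (0 : R).
  pose g k v w := eta v ord0 k *
    residual X (xi k) (ito_follmer_integral Pi (xi k) X) v w.
  have g0 k : psums Pi N (g k) 0 t @ \oo --> (0 : R).
    apply: (weighted_admissible_residual_cvg0 Pi0 Pi_lt PiN Pi_fine T0 X_QV
      (xi_adm k) (eta := fun v => eta v ord0 k)) => // s s0.
      exact: coord_right.
    have [l lP] := coord_left eta_cadlag s0.
    by exists (l ord0 k); exact: lP.
  rewrite [X in X @ _](_ : _ = fun n => \sum_k psums Pi N (g k) 0 t n).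
    exact: cvg_sumr0.
  apply/funext => n.
  rewrite !(riemann_sum_psums Pi0 Pi_lt PiN)// /psums /psum.
  rewrite [RHS]exchange_big/= -sumrB; apply: eq_bigr => i _.
  set v := clamp _ _ _; set w := clamp _ _ _.
  have -> : dot (zeta v) (X w - X v) =
      \sum_(k < nu) eta v ord0 k * increment (xi k) X v w.
    rewrite /dot /zeta; under eq_bigr do rewrite summxE mulr_suml.
    rewrite exchange_big; apply: eq_bigr => k _; rewrite mulr_sumr.
    by apply: eq_bigr => j _; rewrite !mxE mulrA.
  rewrite /dot -sumrB; apply: eq_bigr => k _.
  by rewrite /g /residual !mxE -mulrBr.
rewrite /ito_follmer_integrable /ito_follmer_integral.
set a := fun n => riemann_sum (Pi n) eta Y t.
set b := fun n => riemann_sum (Pi n) zeta X t.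
have ab (l : R) : a @ \oo --> l -> b @ \oo --> l.
  move=> al; have -> : b = fun n => a n - (a n - b n).
    by apply/funext => n; rewrite subKr.
  by rewrite -[l]subr0; apply: cvgB.
have ba (l : R) : b @ \oo --> l -> a @ \oo --> l.
  move=> bl; have -> : a = fun n => (a n - b n) + b n.
    by apply/funext => n; rewrite subrK.
  by rewrite -[l]add0r; apply: cvgD.
split; first by split => /cvg_ex[l lP]; apply/cvg_ex; exists l; auto.
case=> /cvg_ex[l lP].
  by rewrite (cvg_lim _ lP)// (cvg_lim _ (ab l lP)).
by rewrite (cvg_lim _ lP)// (cvg_lim _ (ba l lP)).
Qed.
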